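(* Let $M$ be a complete noncompact Riemannian manifold with a doubling constant $D(M)$, and let $f:M\to\mathbb{R}$ be a $W^{1,1}_{loc}$ weak subsolution of the $1$-harmonic equation $$\operatorname{div}\Big(\frac{\nabla g}{|\nabla g|}\Big)=0\quad\text{on }M$$ with constant $1$-tension field $c$, i.e. $$\operatorname{div}\Big(\frac{\nabla f}{|\nabla f|}\Big)=c$$ on $M$ in the distribution sense. Then $f$ is a $1$-harmonic function.
   Context: $B(x,r)$ is the geodesic ball of radius $r$ centered at $x$, and $dv$ is the Riemannian volume element. Doubling constant of $M$: a constant $D(M)>0$ such that for all $r>0$ and all $x\in M$, $\mathrm{Vol}(B(x,2r))\le D(M)\,\mathrm{Vol}(B(x,r))$. For $f\in W^{1,1}_{loc}(M)$: $f$ is a weak subsolution of the $1$-harmonic equation if $\int_M\frac{\nabla f}{|\nabla f|}\cdot\nabla\psi\,dv\le0$ for all nonnegative $\psi\in C_0^\infty(M)$; $\operatorname{div}(\nabla f/|\nabla f|)=c$ in the distribution sense means $\int_M\frac{\nabla f}{|\nabla f|}\cdot\nabla\psi\,dv=-c\int_M\psi\,dv$ for all $\psi\in C_0^\infty(M)$; and $f$ is a $1$-harmonic function if this holds with $c=0$. Here $\nabla f/|\nabla f|$ is required to make sense almost everywhere. *)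

(* Defs.v *)
From HB Require Import structures.
From mathcomp Require Import all_boot all_order all_algebra.
From mathcomp Require Import all_classical all_reals all_analysis.

Set Implicit Arguments.
Unset Strict Implicit.
Unset Printing Implicit Defensive.

Import Order.TTheory GRing.Theory Num.Theory.
Import numFieldNormedType.Exports.

Local Open Scope classical_set_scope.
Local Open Scope ring_scope.

(* Points and tangent vectors of R^n are row vectors. *)

(* [T] with its Borel sigma-algebra *)
Notation borel T := (g_sigma_algebraType (@open T)).

Section Euclidean.
Variables (R : realType) (n : nat).
Implicit Types (U : set 'rV[R]_n).

Definition basis_vec (j : 'I_n) : 'rV[R]_n := delta_mx 0 j.

(* [C_on k U f]: all iterated directional derivatives of [f] of order at most
   [k] exist on [U] and those of order [k] are continuous on [U].  For open [U]
   this is the usual class C^k. *)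
Fixpoint C_on (W : normedModType R) (k : nat) U (f : 'rV[R]_n -> W) : Prop :=
  if k is k'.+1 then
    forall v, (forall y, U y -> derivable f y v) /\
              C_on k' U (fun y => 'D_v f y)
  else forall y, U y -> {for y, continuous f}.

Definition smooth_on (W : normedModType R) U (f : 'rV[R]_n -> W) : Prop :=
  forall k, C_on k U f.

Definition Cc_smooth U (eta : 'rV[R]_n -> R^o) : Prop :=
  [/\ smooth_on setT eta,
      compact (closure [set y | eta y != 0]) &
      closure [set y | eta y != 0] `<=` U].

Definition C1_curve (c : R -> 'rV[R]_n) : Prop :=
  (forall t, derivable c t 1) /\ continuous (derive1 c).

End Euclidean.

(* n-dimensional Lebesgue measure on Borel sets, as an iterated integral: the
   measure of [A] is the integral over x of the (n-1)-dimensional measure of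
   the slice of [A] with first coordinate x. *)
Fixpoint leb (R : realType) (n : nat) : set (borel 'rV[R]_n) -> \bar R :=
  match n with
  | 0 => fun A => (\1_A 0)%:E
  | m.+1 => fun A =>
      (\int[lebesgue_measure]_x
         leb [set y : 'rV[R]_m | A (row_mx (x%:M : 'rV[R]_1) y)])%E
  end.

Definition loc_integrable (R : realType) (n : nat) (V : set 'rV[R]_n)
    (h : 'rV[R]_n -> R) : Prop :=
  forall K : set 'rV[R]_n, compact K -> K `<=` V ->
    (@leb R n).-integrable (K : set (borel 'rV[R]_n)) (fun y => (h y)%:E).

(* A smooth Riemannian manifold of dimension [n], given by a smooth atlas and
   the coordinate matrices of the metric.  Only the values of [chart i] on
   [chart_dom i], and of [chart_inv i] and [metric i] on its image, are
   meaningful.  [chart_at x] is a preferred chart around [x]: a tangent vector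
   at [x] is represented by its components in the chart [chart_at x].
   Connectedness is not required. *)
Record riemannianManifold (R : realType) (n : nat) := RiemannianManifold {
  carrier :> ptopologicalType ;
  carrier_hausdorff : hausdorff_space carrier ;
  carrier_second_countable : @second_countable carrier ;
  chart_index : Type ;
  chart_dom : chart_index -> set carrier ;
  chart : chart_index -> carrier -> 'rV[R]_n ;
  chart_inv : chart_index -> 'rV[R]_n -> carrier ;
  chart_cod := fun i => chart i @` chart_dom i ;
  chart_dom_open : forall i, open (chart_dom i) ;
  chart_cod_open : forall i, open (chart_cod i) ;
  chartK : forall i x, chart_dom i x -> chart_inv i (chart i x) = x ;
  chart_continuous : forall i x, chart_dom i x -> {for x, continuous (chart i)} ;
  chart_inv_continuous : forall i y, chart_cod i y ->
    {for y, continuous (chart_inv i)} ;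
  chart_at : carrier -> chart_index ;
  mem_chart_at : forall x, chart_dom (chart_at x) x ;
  transition_smooth : forall i j,
    smooth_on (chart i @` (chart_dom i `&` chart_dom j))
              (chart j \o chart_inv i) ;
  metric : chart_index -> 'rV[R]_n -> 'M[R]_n ;
  metric_smooth : forall i, smooth_on (chart_cod i) (metric i) ;
  metric_sym : forall i y, chart_cod i y -> (metric i y)^T = metric i y ;
  metric_pos : forall i y (v : 'rV[R]_n), chart_cod i y -> v != 0 ->
    0 < (v *m metric i y *m v^T) 0 0 ;
  (* the matrices represent the same inner product on each tangent space *)
  metric_compat : forall i j x (u v : 'rV[R]_n),
    chart_dom i x -> chart_dom j x ->
    (u *m metric i (chart i x) *m v^T) 0 0 =
    ('D_u (chart j \o chart_inv i) (chart i x) *m metric j (chart j x)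
       *m ('D_v (chart j \o chart_inv i) (chart i x))^T) 0 0
}.

Section Geometry.
Variables (R : realType) (n : nat) (M : riemannianManifold R n).
Implicit Types (x y : M) (i : chart_index M) (u v : 'rV[R]_n).

Definition curve_length i (c : R -> 'rV[R]_n) : R :=
  (\int[lebesgue_measure]_(t in `[0%R, 1%R])
     Num.sqrt ((derive1 c t *m metric i (c t) *m (derive1 c t)^T) 0 0))%R.

(* [C1_path_length x y L]: some piecewise C^1 curve from [x] to [y], cut into
   finitely many C^1 pieces each contained in a chart domain, has length [L]. *)
Inductive C1_path_length (x : M) : M -> R -> Prop :=
| C1_path_nil : C1_path_length x x 0
| C1_path_rcons y L i (c : R -> 'rV[R]_n) :
    C1_path_length x y L ->
    C1_curve c ->
    (forall t, 0 <= t <= 1 -> chart_cod i (c t)) ->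
    chart_inv i (c 0) = y ->
    C1_path_length x (chart_inv i (c 1)) (L + curve_length i c).

(* +oo between distinct connected components *)
Definition geodesic_dist x y : \bar R :=
  ereal_inf [set L%:E | L in C1_path_length x y].

Definition geodesic_ball x (r : R) : set M :=
  [set y | (geodesic_dist x y < r%:E)%E].

Definition complete_manifold : Prop :=
  forall s : nat -> M,
    (forall e : R, 0 < e -> exists N : nat, forall k l : nat,
       (N <= k)%N -> (N <= l)%N -> (geodesic_dist (s k) (s l) < e%:E)%E) ->
    exists x, geodesic_dist (s k) x @[k --> \oo] --> 0%E.

Definition inner x u v : R :=
  (u *m metric (chart_at x) (chart (chart_at x) x) *m v^T) 0 0.

Definition tnorm x u : R := Num.sqrt (inner x u u).

(* the components in the chart [i] of the tangent vector [u] at [x] *)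
Definition components i x u : 'rV[R]_n :=
  'D_u (chart i \o chart_inv (chart_at x)) (chart (chart_at x) x).

(* Since a second countable manifold has a countable atlas, at most one Borel
   measure satisfies this: the Riemannian volume, dv = sqrt (det g) dy. *)
Definition is_riemannian_volume (mu : set (borel M) -> \bar R) : Prop :=
  forall i (A : set (borel M)), measurable A -> A `<=` chart_dom i ->
    mu A = (\int[@leb R n]_(y in chart i @` A)
              (Num.sqrt (\det (metric i y)))%:E)%E.

Definition doubling_constant (mu : set (borel M) -> \bar R) (D : R) : Prop :=
  0 < D /\
  forall (r : R) x, 0 < r ->
    (mu (geodesic_ball x (2 * r)) <= D%:E * mu (geodesic_ball x r))%E.

(* C_0^oo(M) *)
Definition test_function (psi : M -> R) : Prop :=
  (forall i, smooth_on (chart_cod i) (psi \o chart_inv i : 'rV[R]_n -> R^o)) /\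
  compact (closure [set x | psi x != 0]).

(* gradient of a smooth function: g(grad psi, _) = d psi *)
Definition grad (psi : M -> R) x : 'rV[R]_n :=
  let i := chart_at x in
  (\row_j 'D_(basis_vec R j) (psi \o chart_inv i : 'rV[R]_n -> R^o) (chart i x))
    *m invmx (metric i (chart i x)).

(* [is_weak_gradient f X]: [f] is in W^{1,1}_loc with weak gradient the vector
   field [X].  In each chart, the covector g(X, _) has locally integrable
   components, which are the weak partial derivatives of [f]. *)
Definition is_weak_gradient (f : M -> R) (X : M -> 'rV[R]_n) : Prop :=
  forall i,
    let F := f \o chart_inv i in
    let dF := fun y : 'rV[R]_n => components i (chart_inv i y) (X (chart_inv i y))
                         *m metric i y in
    loc_integrable (chart_cod i) F /\
    forall j : 'I_n,
      loc_integrable (chart_cod i) (fun y : 'rV[R]_n => dF y 0 j) /\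
      forall eta : 'rV[R]_n -> R^o, Cc_smooth (chart_cod i) eta ->
        (\int[@leb R n]_(y in (chart_cod i : set (borel 'rV[R]_n)))
            (F y * 'D_(basis_vec R j) eta y)%:E =
         - \int[@leb R n]_(y in (chart_cod i : set (borel 'rV[R]_n)))
            (dF y 0 j * eta y)%:E)%E.

Variable mu : {measure set (borel M) -> \bar R}.

(* [X] is the weak gradient of [f] and X / |X| makes sense almost everywhere *)
Definition normalizable_gradient (f : M -> R) (X : M -> 'rV[R]_n) : Prop :=
  is_weak_gradient f X /\ {ae mu, forall x, X x != 0}.

(* The integral over M of (X / |X|) . grad psi; weak gradients are unique up to
   null sets, so for such X the integral depends only on the function. *)
Definition tension_pairing (X : M -> 'rV[R]_n) (psi : M -> R) : R :=
  (\int[mu]_x inner x ((tnorm x (X x))^-1 *: X x) (grad psi x))%R.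

Definition weak_subsolution (f : M -> R) : Prop :=
  exists2 X, normalizable_gradient f X &
    forall psi, test_function psi -> (forall x, 0 <= psi x) ->
      tension_pairing X psi <= 0.

(* div (grad f / |grad f|) = c in the distribution sense *)
Definition constant_tension (f : M -> R) (c : R) : Prop :=
  exists2 X, normalizable_gradient f X &
    forall psi, test_function psi ->
      tension_pairing X psi = - c * (\int[mu]_x psi x)%R.

Definition one_harmonic (f : M -> R) : Prop := constant_tension f 0.

End Geometry.

(* Main.v *)
Require Import Defs.
From HB Require Import structures.
From mathcomp Require Import all_boot all_order all_algebra.
From mathcomp Require Import all_classical all_reals all_analysis.
From mathcomp Require Import perm measurable_realfun ring lra.

(** Pairing the equation with a test function u gives
      c * int u = - int (X / |X|) . grad u,
    and the right-hand side only sees the size of grad u, because X / |X| has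
    norm at most 1.  Take for u a cutoff equal to 1 on the ball B(x0, r),
    vanishing outside B(x0, 2 r), with |grad u| <= C / r for a constant C
    independent of r.  Doubling then gives
      |c| V(r) <= |c| int u <= (C / r) V(2 r) <= (C D / r) V(r),
    so |c| r <= C D for every r, which forces c = 0
    ([tension_constant_bound]).  Dividing by V(r) requires a centre x0 all of
    whose balls have positive volume.  If there is none, then every point has
    a null ball, compact sets are null ([null_of_locally_null]), and both sides
    of the equation vanish on every test function, whatever c is.

    The cutoffs have to be smooth, whereas the distance to x0 is only
    Lipschitz, and no multiple of the covering number of a ball may enter C.
    A chart around q gives a bump b equal to 1 at q, supported in B(q, d), with
    |db| <= C / d, for all small d ([exists_bump]).  Let q range over a fine
    net of B(x0, a) and take the soft maximum (1 / l) log (mean exp (l b_q)):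
    its differential is a convex combination of the db_q, hence still bounded
    by C / d however many bumps overlap ([softmax_derive]).  Composed with a
    smooth step it is 1 on B(x0, a) and 0 outside B(x0, a + d)
    ([level_cutoff]).  Adding up K = r / d such levels, for increasing a, and
    dividing by K, one gets the cutoff: at each point at most one level has a
    nonzero differential, since a function is critical at its extrema, so
    the sum is bounded by C / d and the quotient by C / r ([staircase],
    [exists_cutoff]).

    Smooth functions are compared with the distance by integrating along
    curves: |du| <= L makes u an L-Lipschitz function ([path_lipschitz]).
    Applied to the bumps, this also shows that the geodesic balls generate
    the topology ([nbhs_gball], [gball_nbhs]).

    That bounded sets are relatively compact, needed for the test functions to
    have compact support and for the scale d to be chosen uniformly, follows
    from doubling and completeness: small balls have finite volume
    ([vol_small_ball]), hence all balls do; balls of equal radius centred in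
    a bounded set have volumes bounded below, so bounded sets are totally
    bounded ([packing_bound]); and complete totally bounded sets are compact
    ([compact_closure_bounded]).

    Finally, the bounds on volumes and on integrals over M come from
    monotonicity of the integral of nonnegative functions, which is valid
    without measurability.  This avoids discussing the measurability of X on
    the manifold, and of the slices in the iterated integral that defines the
    Lebesgue measure. *)

Set Implicit Arguments.
Unset Strict Implicit.
Unset Printing Implicit Defensive.

Import Order.TTheory GRing.Theory Num.Theory.
Import numFieldNormedType.Exports.

Local Open Scope classical_set_scope.
Local Open Scope ring_scope.

(** * Directional derivatives and smooth functions of several variables *)
Section Calculus.
Variables (R : realType).

Lemma is_derive_line (V W : normedModType R) (f : V -> W) (y v : V) (s : R) :
  derivable f (s *: v + y) v ->
  is_derive s 1 (fun t : R => f (t *: v + y)) ('D_v f (s *: v + y)).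
Proof.
move=> df.
have E : (fun h : R => h^-1 *: (((fun t : R => f (t *: v + y)) \o shift s) (h *: (1:R)) -
   f (s *: v + y))) =
   (fun h : R => h^-1 *: ((f \o shift (s *: v + y)) (h *: v) - f (s *: v + y))).
  apply/funext => h /=; congr (_ *: (f _ - _)).
  by rewrite addrA -scalerDl [h *: 1]mulr1.
by split; rewrite /derivable /derive E.
Qed.

(** The usual chain rule asks for differentiability of the inner function; a
    directional derivative is enough here, since only the line through [y]
    with direction [v] matters. *)
Lemma is_derive_comp1 (V : normedModType R) (f : V -> R) (h : R -> R) y v a b :
  is_derive y v f a -> is_derive (f y) 1 h b -> is_derive y v (h \o f) (b * a).
Proof.
move=> df dh.
have dF : is_derive (0 : R) 1 (fun t : R => f (t *: v + y)) a.
  have [fd <-] := df.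
  by have := @is_derive_line _ _ f y v 0; rewrite scale0r add0r => /(_ fd).
have dH : is_derive ((fun t : R => f (t *: v + y)) 0) 1 h b by rewrite scale0r add0r.
have [H1 H2] := @is_derive1_comp _ _ _ _ _ _ dH dF.
have E : (fun t : R => t^-1 *: (((h \o (fun t : R => f (t *: v + y))) \o shift 0) (t *: (1:R)) -
   (h \o (fun t : R => f (t *: v + y))) 0)) =
   (fun t : R => t^-1 *: (((h \o f) \o shift y) (t *: v) - (h \o f) y)).
  apply/funext => t /=; congr (_ *: (h (f _) - h (f _))).
    by rewrite addr0 [t *: 1]mulr1.
  by rewrite scale0r add0r.
move: H1 H2; rewrite /derivable /derive E => H1 H2.
by split => //; rewrite /derive H2.
Qed.

Lemma is_derive_scale (V : normedModType R) (f : V -> R) y v (k : R) :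
  derivable f y v -> is_derive y (k *: v) f (k * 'D_v f y).
Proof.
move=> df.
have dF : is_derive ( *:%R k 0 : R) 1 (fun t : R => f (t *: v + y)) ('D_v f y).
  by have := @is_derive_line _ _ f y v 0; rewrite scaler0 scale0r add0r => /(_ df).
have dk : is_derive (0 : R) 1 ( *:%R k : R -> R) k.
  by have := @is_deriveZ _ _ _ id k (0 : R) (1 : R) _ (is_derive_id _ _); rewrite [_ *: 1]mulr1.
have [H1 H2] := @is_derive1_comp _ _ _ _ _ _ dF dk.
have E : (fun t : R => t^-1 *: ((((fun t : R => f (t *: v + y)) \o *:%R k) \o shift 0) (t *: (1:R)) -
   ((fun t : R => f (t *: v + y)) \o *:%R k) 0)) =
   (fun t : R => t^-1 *: ((f \o shift y) (t *: (k *: v)) - f y)).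
  apply/funext => t /=; congr (_ *: (f _ - f _)).
    by rewrite addr0 [t *: 1]mulr1 scalerA mulrC.
  by rewrite scaler0 scale0r add0r.
move: H1 H2; rewrite /derivable /derive E => H1 H2.
by split => //; rewrite /derive H2 mulrC.
Qed.

Lemma MVT_dir (V : normedModType R) (f : V -> R) y v :
  (forall s : R, 0 <= s <= 1 -> derivable f (s *: v + y) v) ->
  exists2 s : R, 0 <= s <= 1 & f (v + y) - f y = 'D_v f (s *: v + y).
Proof.
move=> df.
pose F (t : R) : R := f (t *: v + y).
pose F' (s : R) : R := 'D_v f (s *: v + y).
have dF (s : R) : 0 <= s <= 1 -> is_derive s 1 F (F' s).
  by move=> s01; apply: is_derive_line; exact: df.
have H1 (x : R) : x \in `]0, 1[%R -> is_derive x 1 F (F' x).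
  by rewrite in_itv /= => /andP[x0 x1]; apply: dF; rewrite !ltW.
have H2 : {within `[0, 1], continuous F}.
  apply: derivable_within_continuous => x; rewrite in_itv /= => x01.
  by have [] := dF x x01.
have [s s01] := MVT_segment ler01 H1 H2.
rewrite /F /F' scale1r scale0r add0r subr0 mulr1 => E.
by exists s => //; move: s01; rewrite in_itv.
Qed.

Variable n : nat.
Local Notation E := 'rV[R]_n.
Implicit Types (U : set E).

Lemma open_near (T : topologicalType) (U : set T) (P : T -> Prop) y :
  open U -> U y -> (forall z, U z -> P z) -> \forall z \near y, P z.
Proof. by move=> oU Uy UP; apply: (filterS UP); exact: open_nbhs_nbhs (conj oU Uy). Qed.

Lemma C_on_eq (W : normedModType R) k U (f g : E -> W) : open U ->
  (forall y, U y -> f y = g y) -> C_on k U f -> C_on k U g.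
Proof.
move=> oU; elim: k f g => [|k IH] f g fg /=.
  move=> cf y Uy; rewrite /prop_for /continuous_at -(fg _ Uy).
  have nE : \forall z \near y, f z = g z := open_near oU Uy fg.
  exact: cvg_trans (near_eq_cvg nE) (cf y Uy).
move=> Cf v; have [df Cdf] := Cf v.
have nE y : U y -> \forall z \near y, f z = g z.
  by move=> Uy; exact: open_near oU Uy fg.
split=> [y Uy|]; first by apply: near_eq_derivable (df y Uy); exact: nE.
by apply: IH Cdf => y Uy; apply: near_eq_derive; exact: nE.
Qed.

Lemma smooth_on_eq (W : normedModType R) U (f g : E -> W) : open U ->
  (forall y, U y -> f y = g y) -> smooth_on U f -> smooth_on U g.
Proof. by move=> oU fg sf k; exact: C_on_eq (sf k). Qed.

Lemma smooth_on_local (W : normedModType R) U (f : E -> W) :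
  (forall y, U y -> exists2 V, V y & smooth_on V f) -> smooth_on U f.
Proof.
move=> H k.
have {}H y : U y -> exists2 V, V y & C_on k V f.
  by move=> /H[V Vy sV]; exists V.
elim: k f H => [|k IH] f H /=; first by move=> y /H[V Vy]; exact.
move=> v; split=> [y /H[V Vy /(_ v)[+ _]]|]; first exact.
by apply: IH => y /H[V Vy /(_ v)[_ ?]]; exists V.
Qed.

(** Smoothness is the existence of all iterated directional derivatives, so
    to establish it for a whole class of functions it is enough that the class
    consists of continuous functions and is stable by directional derivatives. *)
Lemma smooth_on_coind (W : normedModType R) U (P : (E -> W) -> Prop) : open U ->
  (forall f, P f -> (forall y, U y -> {for y, continuous f}) /\
    forall v, exists2 g, P g & forall y, U y -> is_derive y v f (g y)) ->
  forall f, P f -> smooth_on U f.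
Proof.
move=> oU H f Pf k; elim: k f Pf => [|k IH] f Pf; first by have [] := H f Pf.
move=> v; have [_ /(_ v)[g Pg fg]] := H f Pf.
split=> [y Uy|]; first by have [] := fg y Uy.
apply: (@C_on_eq _ _ _ g) => //; last exact: IH.
by move=> y Uy; have [_ ->] := fg y Uy.
Qed.

Lemma smooth_on_continuous (W : normedModType R) U (f : E -> W) :
  smooth_on U f -> forall y, U y -> {for y, continuous f}.
Proof. by move=> /(_ 0%N). Qed.

Lemma smooth_on_derivable (W : normedModType R) U (f : E -> W) v y :
  smooth_on U f -> U y -> derivable f y v.
Proof. by move=> /(_ 1%N)/(_ v)[+ _]; exact. Qed.

Lemma smooth_on_derive (W : normedModType R) U (f : E -> W) v :
  smooth_on U f -> smooth_on U ('D_v f).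
Proof. by move=> sf k; have [] := sf k.+1 v. Qed.

Arguments smooth_on_derivable {W U f} v {y}.
Arguments smooth_on_derive {W U f} v.

(** Stability by derivation of a class of functions of one variable: this is
    what makes the chain rule iterate in [smooth_algebraP]. *)
Definition derive_closed (I : set R) (F : (R -> R) -> Prop) :=
  forall h, F h -> exists2 h', F h' & forall t, I t -> is_derive t 1 h (h' t).

(** The derivative of a product or of a composite is a sum of products of
    functions of the same kind, but not itself a product or a composite.
    Closing under all the operations at once gives a class to which
    [smooth_on_coind] applies. *)
Inductive smooth_algebra U : (E -> R) -> Prop :=
| salg_base f : smooth_on U (f : E -> R^o) -> smooth_algebra U f
| salg_add f g : smooth_algebra U f -> smooth_algebra U g -> smooth_algebra U (f + g)
| salg_mul f g : smooth_algebra U f -> smooth_algebra U g -> smooth_algebra U (f * g)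
| salg_comp I F (h : R -> R) f : derive_closed I F -> F h ->
    (forall y, U y -> I (f y)) -> smooth_algebra U f ->
    smooth_algebra U (h \o f).

Lemma smooth_algebraP U f : open U -> smooth_algebra U f -> smooth_on U (f : E -> R^o).
Proof.
move=> oU; apply: (@smooth_on_coind R^o) => // {}f.
elim=> {f} [f sf|f g _ [cf df] _ [cg dg]|f g sf [cf df] sg [cg dg]
           |I F h f HF Fh fI sf [cf df]].
- split=> [y Uy|v]; first exact: smooth_on_continuous Uy.
  exists ('D_v f); first exact/salg_base/smooth_on_derive.
  by move=> y Uy; apply: derivableP; exact: smooth_on_derivable Uy.
- split=> [y Uy|v]; first by apply: continuousD; [exact: cf|exact: cg].
  have [f' Pf' ff'] := df v; have [g' Pg' gg'] := dg v.
  exists (f' + g'); first exact: salg_add.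
  by move=> y Uy; have := ff' _ Uy; have := gg' _ Uy => ? ?; exact: is_deriveD.
- split=> [y Uy|v]; first by apply: continuousM; [exact: cf|exact: cg].
  have [f' Pf' ff'] := df v; have [g' Pg' gg'] := dg v.
  exists (f * g' + g * f'); first by apply: salg_add; exact: salg_mul.
  by move=> y Uy; have := ff' _ Uy; have := gg' _ Uy => ? ?; exact: is_deriveM.
- split=> [y Uy|v].
    apply: continuous_comp; first exact: cf.
    have [h' _ dh] := HF h Fh.
    have [dhy _] := dh _ (fI _ Uy).
    exact/differentiable_continuous/derivable1_diffP.
  have [h' Fh' hh'] := HF h Fh; have [f' Pf' ff'] := df v.
  exists ((h' \o f) * f').
    by apply: salg_mul => //; exact: salg_comp HF Fh' fI sf.
  by move=> y Uy; apply: is_derive_comp1; [exact: ff'|exact/hh'/fI].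
Qed.

Lemma smooth_on_cst U (a : R) : open U -> smooth_on U (cst a : E -> R^o).
Proof.
move=> oU; apply: (@smooth_on_coind R^o _ (fun f => exists b, f = cst b)) => [//||]; last by exists a.
move=> _ [b ->]; split=> [y _|v]; first exact: cst_continuous.
exists (cst 0); first by exists 0.
by move=> y _; exact: is_derive_cst.
Qed.

Lemma smooth_onD U (f g : E -> R^o) : open U ->
  smooth_on U f -> smooth_on U g -> smooth_on U (f + g).
Proof.
by move=> oU sf sg; apply: (smooth_algebraP oU); apply: salg_add; exact: salg_base.
Qed.

Lemma smooth_onM U (f g : E -> R^o) : open U ->
  smooth_on U f -> smooth_on U g -> smooth_on U ((f : E -> R) * g : E -> R).
Proof.
by move=> oU sf sg; apply: (smooth_algebraP oU); apply: salg_mul; exact: salg_base.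
Qed.

Lemma smooth_on_affine U (a b : R) (f : E -> R^o) : open U ->
  smooth_on U f -> smooth_on U (fun y => a + b * (f y : R) : R^o).
Proof.
move=> oU sf; apply: smooth_on_eq (smooth_onD oU (smooth_on_cst a oU)
  (smooth_onM oU (smooth_on_cst b oU) sf)) => //.
Qed.

Lemma smooth_on_comp U I F (h : R -> R) (f : E -> R^o) : open U ->
  derive_closed I F -> F h -> (forall y, U y -> I (f y)) ->
  smooth_on U f -> smooth_on U (h \o f : E -> R^o).
Proof.
by move=> oU HF Fh If sf; apply: (smooth_algebraP oU); apply: (salg_comp HF Fh If); exact: salg_base.
Qed.

Lemma smooth_on_sum U (I : Type) (s : seq I) (f : I -> E -> R^o) : open U ->
  (forall i, smooth_on U (f i)) -> smooth_on U (fun y => \sum_(i <- s) f i y : R^o).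
Proof.
move=> oU sf; elim: s => [|i s IH].
  by apply: smooth_on_eq (@smooth_on_cst U 0 oU) => // y _; rewrite big_nil.
apply: smooth_on_eq (smooth_onD oU (sf i) IH) => // y _.
by rewrite big_cons.
Qed.

Lemma is_derive_coord (V : normedModType R) m (f : V -> 'rV[R]_m) y v j :
  derivable f y v -> is_derive y v (fun y => f y 0 j : R^o) ('D_v f y 0 j).
Proof.
move=> df.
have C : (fun h : R => h^-1 *: (((fun y => f y 0 j : R^o) \o shift y) (h *: v) - f y 0 j)) @ 0^'
     --> ('D_v f y 0 j : R^o).
  rewrite (_ : (fun _ => _) = (fun M : 'rV[R]_m => M 0 j : R^o) \o
      (fun h : R => h^-1 *: ((f \o shift y) (h *: v) - f y))); last first.
    by apply/funext => h /=; rewrite !mxE.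
  by apply: continuous_cvg; [exact: coord_continuous|exact: df].
split; first by apply/cvg_ex; exists ('D_v f y 0 j : R^o).
exact: cvg_lim C.
Qed.

Lemma smooth_on_coord U m (f : E -> 'rV[R]_m) j : open U ->
  smooth_on U f -> smooth_on U (fun y => f y 0 j : R^o).
Proof.
move=> oU sf.
pose P (g : E -> R^o) := exists2 f : E -> 'rV[R]_m, smooth_on U f & g = fun y => f y 0 j.
have Pf : P (fun y => f y 0 j) by exists f.
apply: (@smooth_on_coind R^o U P oU _ _ Pf).
move=> _ [{sf Pf}f sf ->]; split=> [y Uy|v].
  apply: (@continuous_comp _ _ _ f (fun M : 'rV[R]_m => M 0 j)); first exact: smooth_on_continuous Uy.
  exact: coord_continuous.
exists (fun y => 'D_v f y 0 j); first by exists ('D_v f) => //; exact: smooth_on_derive.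
by move=> y Uy; apply: is_derive_coord; exact: (smooth_on_derivable v sf Uy).
Qed.

Lemma le_entry_norm m k (A : 'M[R]_(m, k)) i j : `|A i j| <= `|A|.
Proof.
rewrite [leRHS]/Num.norm /= mx_normrE; apply/bigmax_geP; right => /=.
by exists (i, j).
Qed.

Lemma differentiable_eps (V W : normedModType R) (f : V -> W)
    (L : {linear V -> W}) y : continuous L ->
  (forall e : R, 0 < e ->
    \forall h \near 0, `|f (h + y) - f y - L h| <= e * `|h|) ->
  differentiable f y.
Proof.
move=> cL H.
suff H' : f \o shift y = cst (f y) + L +o_ 0 id.
  by apply/diff_locallyP; rewrite (diff_unique cL H').
apply/eqaddoP => e e0; near=> h.
rewrite [X in `|X|](_ : _ = f (h + y) - f y - L h); last first.
  by rewrite /= -addrA -opprD.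
by near: h; exact: H.
Unshelve. all: by end_near. Qed.

Lemma gradient_linear (a : 'I_n -> R) :
  linear (fun h : E => \sum_j h 0 j * a j : R^o).
Proof.
move=> k u v /=; rewrite scaler_sumr -big_split; apply: eq_bigr => j _.
by rewrite !mxE mulrDl [_ *: _]mulrA.
Qed.

Lemma coord_linear_continuous (a : 'I_n -> R) :
  continuous (fun h : E => \sum_j h 0 j * a j : R^o).
Proof.
apply: continuous_big => [|j _]; first exact: add_continuous.
by move=> h; apply: continuousM; [exact: coord_continuous|exact: cst_continuous].
Qed.

(** The classical criterion: continuous partial derivatives imply
    differentiability.  The increment is telescoped along a path of segments
    parallel to the axes, and the mean value theorem is applied on each of
    them.  This is the only bridge from iterated directional derivatives to
    linearity in the direction and to the chain rule along curves. *)
Lemma smooth_on_differentiable U (f : E -> R^o) y : open U ->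
  smooth_on U f -> U y -> differentiable f y.
Proof.
move=> oU sf Uy.
pose a j := 'D_(basis_vec R j) f y.
have [L LE cL] : exists2 L : {linear E -> R^o},
    forall h, L h = \sum_j h 0 j * a j & continuous L.
  pose L : {linear E -> R^o} := HB.pack (fun h : E => \sum_j h 0 j * a j : R^o)
    (GRing.isLinear.Build R E R^o *:%R _ (@gradient_linear a)).
  exists L => //.
  exact: coord_linear_continuous.
apply: (differentiable_eps cL) => _/posnumP[e].
pose e' := e%:num / (n%:R + 1).
have e'0 : 0 < e' by rewrite divr_gt0// ltr_wpDl.
have : \forall z \near y, U z /\ forall j, `|'D_(basis_vec R j) f z - a j| <= e'.
  apply: filterI; first exact: open_near oU Uy _.
  apply: (@filter_forall _ _ (fun j z => `|'D_(basis_vec R j) f z - a j| <= e') (nbhs y) _) => j.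
  have := smooth_on_continuous (smooth_on_derive (basis_vec R j) sf) Uy.
  move=> /cvgr_distC_le; exact.
move=> /nbhs_ballP[d /= d0 yd].
near=> h.
have hd j : `|h 0 j| < d.
  apply: le_lt_trans (le_entry_norm _ _ _) _.
  by near: h; exact: (@nbhs0_lt _ E).
(* A path from 0 to [h], one coordinate at a time. *)
pose p k : E := \row_j (if (j < k)%N then h 0 j else 0).
have pn : p n = h by apply/rowP => j; rewrite mxE ltn_ord.
have p0 : p 0%N = 0 by apply/rowP => j; rewrite !mxE.
have pS (k : 'I_n) : p k.+1 = h 0 k *: basis_vec R k + p k.
  apply/rowP => j; rewrite !mxE eqxx /= ltnS leq_eqVlt -val_eqE /=.
  by case: ltngtP; rewrite ?mulr0 ?mulr1 ?add0r ?addr0// => /val_inj ->.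
have ballp (k : 'I_n) (s : R) : 0 <= s <= 1 ->
    ball y d (s *: (h 0 k *: basis_vec R k) + (p k + y)).
  move=> /andP[s0 s1]; split=> // i j; rewrite ord1 /ball /= !mxE eqxx /=.
  rewrite addrA opprD addrCA addrN addr0 normrN.
  case: ltngtP => [jk|kj|/val_inj ->]; rewrite ?eqxx ?mulr1.
  - by rewrite (_ : j == k = false) ?mulr0 ?add0r// -val_eqE /= ltn_eqF.
  - by rewrite (_ : j == k = false) ?mulr0 ?add0r ?normr0// -val_eqE /= gtn_eqF.
  - rewrite addr0 normrM (le_lt_trans _ (hd k))// ler_piMl//.
    by rewrite ger0_norm.
have step (k : 'I_n) :
    `|f (p k.+1 + y) - f (p k + y) - h 0 k * a k| <= e' * `|h|.
  rewrite pS -[X in f X - _ - _]addrA.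
  have [s s01|s s01 ->] := @MVT_dir _ f (p k + y) (h 0 k *: basis_vec R k).
    by have [Uz _] := yd _ (ballp k s s01); exact: smooth_on_derivable Uz.
  have [Uz /(_ k) Hk] := yd _ (ballp k s s01).
  have [_ ->] := is_derive_scale (h 0 k) (smooth_on_derivable (basis_vec R k) sf Uz).
  rewrite -mulrBr normrM mulrC ler_pM//; exact: le_entry_norm.
have -> : f (h + y) - f y - L h =
   \sum_(k < n) (f (p k.+1 + y) - f (p k + y) - h 0 k * a k).
  rewrite sumrB -(big_mkord xpredT (fun k => f (p k.+1 + y) - f (p k + y))).
  by rewrite LE telescope_sumr// pn p0 add0r.
apply: le_trans (ler_norm_sum _ _ _) _.
apply: (@le_trans _ _ (\sum_(k < n) (e' * `|h|))); first exact: ler_sum.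
rewrite sumr_const card_ord -mulr_natl mulrA ler_wpM2r//.
by rewrite /e' mulrCA ler_piMr// ler_pdivrMr ?mul1r ?lerDl// ltr_wpDl.
Unshelve. all: by end_near. Qed.

Lemma smooth_on_derive_sum U (f : E -> R^o) y v : open U ->
  smooth_on U f -> U y ->
  'D_v f y = \sum_j v 0 j * 'D_(basis_vec R j) f y.
Proof.
move=> oU sf Uy; have df := smooth_on_differentiable oU sf Uy.
rewrite deriveE// {1}(row_sum_delta v) linear_sum.
by apply: eq_bigr => j _; rewrite linearZ deriveE.
Qed.

Lemma smooth_on_curve U (f : E -> R^o) (c : R -> E) t : open U ->
  smooth_on U f -> U (c t) -> derivable c t 1 ->
  is_derive t 1 (f \o c : R -> R) ('D_(derive1 c t) f (c t)).
Proof.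
move=> oU sf Uy dc; have df := smooth_on_differentiable oU sf Uy.
have dc' : differentiable c t by apply/derivable1_diffP.
have dfc : differentiable (f \o c) t by exact: differentiable_comp.
apply: DeriveDef; first exact: diff_derivable.
by rewrite deriveE// diff_comp//= deriveE// derive1E'.
Qed.

End Calculus.

Arguments smooth_on_continuous {R n W U f} _ {y} _.
Arguments smooth_on_derivable {R n W U f} v {y} _ _.

(** * A flat function and a smooth step *)
Section OneVariable.
Variable R : realType.
Implicit Types (s t : R).

(** From exp x >= 1 + x applied at x = s / k, and raised to the power k. *)
Lemma expr_le_expR k s : 0 <= s -> s ^+ k <= k%:R ^+ k * expR s.
Proof.
move=> s0; case: k => [|k]; first by rewrite !expr0 mul1r -expR0 ler_expR.
have k0 : 0 < k.+1%:R :> R by [].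
have -> : expR s = expR (s / k.+1%:R) ^+ k.+1.
  by rewrite -expRM_natl mulrC divfK// gt_eqF.
rewrite -exprMn ler_pXn2r ?nnegrE// ?mulr_ge0 ?expR_ge0//.
rewrite -ler_pdivrMl// mulrC (le_trans _ (expR_ge1Dx _))//.
by rewrite lerDr.
Qed.

Lemma is_derive_inv t : t != 0 -> is_derive t 1 (fun s => s^-1) (- t ^- 2).
Proof.
move=> t0; have dV := derivableV t0 (@derivable_id R R t 1).
split; first exact: dV.
by have := deriveV t0 (@derivable_id R R t 1); rewrite derive_id [in RHS]/GRing.scale /= mulr1.
Qed.

Lemma is_derive_pow m t : is_derive t 1 (fun s : R => s ^+ m) (m%:R * t ^+ m.-1).
Proof.
apply: DeriveDef; first exact: exprn_derivable.
by rewrite exp_derive [_ *: 1]mulr1.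
Qed.

(** The powers of 1 / t are carried along because the derivatives of exp (-1/t)
    are combinations of such functions. *)
Definition flat (m : nat) t : R := if 0 < t then t^-1 ^+ m * expR (- t^-1) else 0.

Lemma flat_ge0 m t : 0 <= flat m t.
Proof.
by rewrite /flat; case: ifP => // t0; rewrite mulr_ge0 ?expR_ge0// exprn_ge0// invr_ge0 ltW.
Qed.

Lemma flat_le m t : flat m t <= m%:R ^+ m.
Proof.
rewrite /flat; case: ifP => // t0.
by rewrite expRN ler_pdivrMr ?expR_gt0// expr_le_expR// invr_ge0 ltW.
Qed.

Lemma flatS m t : 0 <= t -> flat m t = t * flat m.+1 t.
Proof.
rewrite /flat; case: ifP => // t0 _; last by rewrite mulr0.
by rewrite exprS -!mulrA mulVKf ?gt_eqF.
Qed.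

Lemma is_derive_flat m t :
  is_derive t 1 (flat m) (flat m.+2 t - m%:R * flat m.+1 t).
Proof.
have [t0|t0|<-] := ltgtP 0 t.
- have H : is_derive t 1 ((fun s => s ^+ m * expR (- s)) \o (fun s => s^-1))
      ((m%:R * t^-1 ^+ m.-1 * expR (- t^-1) - t^-1 ^+ m * expR (- t^-1)) * (- t ^- 2)).
    apply: is_derive_comp1; first by apply: is_derive_inv; rewrite gt_eqF.
    have dX := is_derive_pow m t^-1.
    have dE : is_derive t^-1 1 (fun s : R => expR (- s)) (- expR (- t^-1)).
      have := is_derive1_comp (is_derive_expR (- t^-1)) (is_deriveNid t^-1 1).
      by rewrite mulrN1.
    apply: (is_derive_eq (is_deriveM dX dE)).
    by rewrite /GRing.scale /=; ring.
  have nE : \forall s \near t, ((fun s => s ^+ m * expR (- s)) \o (fun s => s^-1)) s = flat m s.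
    near=> s; rewrite /flat ifT//; near: s; exact: lt_nbhsr.
  apply: (is_derive_eq (near_eq_is_derive nE H)).
  rewrite /flat t0; case: m {H nE} => [|m] /=; rewrite -?exprVn !exprS; ring.
- have nE : \forall s \near t, cst 0 s = flat m s.
    near=> s; rewrite /flat ifF//; apply/negbTE; rewrite -leNgt ltW//.
    by near: s; exact: lt_nbhsl.
  apply: (is_derive_eq (near_eq_is_derive nE (is_derive_cst 0 t 1))).
  by rewrite /flat ltNge (ltW t0) /= mulr0 subr0.
(* At 0 the difference quotient is O(h), as [flat m h = h ^+ 2 * flat m.+2 h]. *)
- have C : (fun h => h^-1 *: ((flat m \o shift 0) (h *: 1) - flat m 0)) @ 0^' --> (0 : R).
    apply/cvgr0Pnorm_le => e e0; near=> h.
    have f0 : flat m 0 = 0 by rewrite /flat ltxx.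
    rewrite (_ : _ *: _ = h^-1 * flat m h); last by rewrite f0 subr0 /= addr0 [h *: 1]mulr1.
    have [h0|h0] := leP 0 h; last first.
      by rewrite /flat ltNge (ltW h0) mulr0 normr0 ltW.
    have hn0 : h != 0 by near: h; exact: nbhs_dnbhs_neq.
    rewrite (flatS _ h0) mulKf// (flatS _ h0) normrM (ger0_norm (flat_ge0 _ _)).
    apply: (@le_trans _ _ (`|h| * m.+2%:R ^+ m.+2)).
      by rewrite ler_wpM2l// flat_le.
    rewrite -ler_pdivlMr ?exprn_gt0//.
    near: h; apply: dnbhs0_le; rewrite divr_gt0 ?exprn_gt0//.
  have cc := cvg_lim (@Rhausdorff R) C.
  apply: DeriveDef; first by apply/cvg_ex; exists 0.
  by rewrite /derive cc /flat ltxx mulr0 subr0.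
Unshelve. all: by end_near. Qed.

(** The functions [flat m] are not closed under derivation, but their linear
    span is. *)
Inductive flat_span : (R -> R) -> Prop :=
| flat_span_base m : flat_span (flat m)
| flat_span_add f g : flat_span f -> flat_span g -> flat_span (f + g)
| flat_span_scale (a : R) f : flat_span f -> flat_span (a \*: (f : R -> R^o)).

Lemma flat_span_closed : derive_closed setT flat_span.
Proof.
move=> h; elim=> {h} [m|f g _ [f' ff' df] _ [g' gg' dg]|a f _ [f' ff' df]].
- exists (flat m.+2 + (- m%:R) \*: (flat m.+1 : R -> R^o)).
    apply: flat_span_add; first exact: flat_span_base.
    by apply: flat_span_scale; exact: flat_span_base.
  move=> t _; apply: is_derive_eq; first exact: is_derive_flat.
  by rewrite /= [in RHS]/GRing.add /= [(- _) *: _]mulNr.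
- exists (f' + g'); first exact: flat_span_add.
  by move=> t tT; have := df t tT; have := dg t tT => ? ?; exact: is_deriveD.
- exists (a \*: (f' : R -> R^o)); first exact: flat_span_scale.
  by move=> t tT; have := df t tT => ?; exact: is_deriveZ.
Qed.

Lemma smooth_on_flat n (U : set 'rV[R]_n) (f : 'rV[R]_n -> R^o) m : open U ->
  smooth_on U f -> smooth_on U (flat m \o f : 'rV[R]_n -> R^o).
Proof.
move=> oU; apply: (smooth_on_comp oU flat_span_closed) => //.
exact: flat_span_base.
Qed.

Lemma smooth_on_expR n (U : set 'rV[R]_n) (f : 'rV[R]_n -> R^o) : open U ->
  smooth_on U f -> smooth_on U (expR \o f : 'rV[R]_n -> R^o).
Proof.
move=> oU; apply: (@smooth_on_comp _ _ _ setT (eq expR)) => // h <-.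
by exists expR => // t _; exact: is_derive_expR.
Qed.

(** The derivatives of ln are scalar multiples of powers of the inverse. *)
Lemma smooth_on_ln n (U : set 'rV[R]_n) (f : 'rV[R]_n -> R^o) : open U ->
  (forall y, U y -> 0 < f y) ->
  smooth_on U f -> smooth_on U (@ln R \o f : 'rV[R]_n -> R^o).
Proof.
move=> oU; pose F (h : R -> R) := h = @ln R \/ exists a m, h = fun t => a * t^-1 ^+ m.
apply: (@smooth_on_comp _ _ _ [set t | 0 < t] F) => //; last by left.
move=> h [->|[a [m ->]]].
  exists (fun t => 1 * t^-1 ^+ 1); first by right; exists 1, 1%N.
  by move=> t t0; rewrite mul1r expr1; exact: is_derive1_ln.
exists (fun t => - (a * m%:R) * t^-1 ^+ m.+1); first by right; exists (- (a * m%:R)), m.+1.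
move=> t /= t0.
have t0' : t != 0 by rewrite gt_eqF.
apply: (is_derive_eq (is_deriveZ a (is_derive_comp1 (is_derive_inv t0') (is_derive_pow m t^-1)))).
rewrite /GRing.scale /= -exprVn; case: m => [|m] /=; rewrite ?mul0r ?mulr0 ?oppr0 ?mul0r// !exprS; ring.
Qed.

(** Two nested flat functions, each normalised by its value at the end of the
    step: exp 4 * [flat 0 t] reaches 1 at t = 1/4, so that the inner argument is
    nonpositive from there on, and is 1 for t <= 0. *)
Definition smooth_step t := 1 - expR 1 * flat 0 (1 - expR 4 * flat 0 t).

Lemma smooth_step_le0 t : t <= 0 -> smooth_step t = 0.
Proof.
move=> t0; rewrite /smooth_step {2}/flat ltNge t0 /= mulr0 subr0 /flat ltr01 invr1 expr0 mul1r.
by rewrite -expRD addrN expR0 subrr.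
Qed.

Lemma smooth_step_ge t : 4^-1 <= t -> smooth_step t = 1.
Proof.
move=> t4; have t0 : 0 < t by rewrite (lt_le_trans _ t4).
rewrite /smooth_step {1}/flat ifF ?mulr0 ?subr0//; apply/negbTE; rewrite -leNgt subr_le0.
rewrite /flat t0 expr0 mul1r -expRD -{1}expR0 ler_expR subr_ge0.
by rewrite -[leRHS]invrK lef_pV2 ?posrE// invr_gt0.
Qed.

Lemma smooth_step01 t : 0 <= smooth_step t <= 1.
Proof.
rewrite /smooth_step subr_ge0 lerBlDr lerDl mulr_ge0 ?flat_ge0 ?expR_ge0// andbT.
set u := 1 - _; have u1 : u <= 1 by rewrite /u lerBlDr lerDl mulr_ge0 ?flat_ge0 ?expR_ge0.
rewrite /flat; case: ifP => u0; last by rewrite mulr0.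
rewrite expr0 mul1r -expRD -[leRHS]expR0 ler_expR subr_le0.
by rewrite -[leLHS]invr1 lef_pV2 ?posrE.
Qed.

Lemma smooth_on_step n (U : set 'rV[R]_n) (f : 'rV[R]_n -> R^o) : open U ->
  smooth_on U f -> smooth_on U (smooth_step \o f : 'rV[R]_n -> R^o).
Proof.
move=> oU sf.
have := smooth_on_affine 1 (- expR 4) oU (smooth_on_flat 0 oU sf).
move=> /(smooth_on_flat 0 oU)/(smooth_on_affine 1 (- expR 1) oU).
apply: smooth_on_eq => // y Uy.
by rewrite /smooth_step /= !mulNr.
Qed.

Definition smooth_step_lip : R := expR 1 * 4 * (expR 4 * 4).

(** A bound on the slope of the step, uniform in [t], is what makes the cutoff
    constant independent of the scale. *)
Lemma smooth_step_derive t :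
  exists2 a : R, is_derive t 1 smooth_step a & `|a| <= smooth_step_lip.
Proof.
have d0 s : is_derive s 1 (flat 0) (flat 2 s).
  by have := is_derive_flat 0 s; rewrite mul0r subr0.
have b0 s : `|flat 2 s| <= 4.
  by rewrite ger0_norm ?flat_ge0// (le_trans (flat_le _ _))// -natrX.
have H (a b : R) (g : R -> R) c : is_derive t 1 g c ->
    is_derive t 1 (fun y => a + b * g y) (b * c).
  move=> dg; apply: (is_derive_eq (is_deriveD (is_derive_cst a t 1) (is_deriveZ b dg))).
  by rewrite add0r.
have H1 := H 1 (- expR 4) _ _ (d0 t).
have := H 1 (- expR 1) _ _ (is_derive1_comp (d0 _) H1) => H2.
exists (expR 1 * flat 2 (1 - expR 4 * flat 0 t) * (expR 4 * flat 2 t)).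
  rewrite (_ : smooth_step = fun y =>
      1 + - expR 1 * (flat 0 \o (fun y : R => 1 + - expR 4 * flat 0 y)) y); last first.
    by apply/funext => s; rewrite /smooth_step /= !mulNr.
  by apply: (is_derive_eq H2); rewrite /= !mulNr; ring.
rewrite /smooth_step_lip !normrM !(ger0_norm (expR_ge0 _)).
by rewrite !ler_pM// ?mulr_ge0// ?expR_ge0// ler_pM// expR_ge0.
Qed.

End OneVariable.

(** * Bilinear forms *)
Section BilinearForms.
Variables (R : realType) (n : nat).
Implicit Types (u v w : 'rV[R]_n) (G : 'M[R]_n).

Definition mform G u v : R := (u *m G *m v^T) 0 0.

Lemma mformE G u v : mform G u v = \sum_j (\sum_i u 0 i * G i j) * v 0 j.
Proof. by rewrite /mform !mxE; apply: eq_bigr => j _; rewrite !mxE. Qed.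

Lemma mformDl G u v w : mform G (u + v) w = mform G u w + mform G v w.
Proof. by rewrite /mform !mulmxDl mxE. Qed.

Lemma mformDr G u v w : mform G u (v + w) = mform G u v + mform G u w.
Proof. by rewrite /mform linearD /= !mulmxDr mxE. Qed.

Lemma mformZl G (a : R) u v : mform G (a *: u) v = a * mform G u v.
Proof. by rewrite /mform -!scalemxAl mxE. Qed.

Lemma mformZr G (a : R) u v : mform G u (a *: v) = a * mform G u v.
Proof. by rewrite /mform linearZ /= -!scalemxAr mxE. Qed.

Lemma mform0l G v : mform G 0 v = 0.
Proof. by rewrite /mform !mul0mx mxE. Qed.

Lemma mformNN G u : mform G (- u) (- u) = mform G u u.
Proof. by rewrite -scaleN1r mformZl mformZr !mulN1r opprK. Qed.

Lemma mform_sym G u v : G^T = G -> mform G u v = mform G v u.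
Proof.
move=> Gs; rewrite /mform -[in LHS](trmxK (u *m G *m v^T)) mxE.
by rewrite !trmx_mul trmxK Gs mulmxA.
Qed.

Definition pos_form G := G^T = G /\ forall v, v != 0 -> 0 < mform G v v.

Lemma pos_form_ge0 G v : pos_form G -> 0 <= mform G v v.
Proof.
by move=> [_ Gp]; have [->|v0] := eqVneq v 0; [rewrite mform0l|rewrite ltW ?Gp].
Qed.

Lemma pos_form_eq0 G v : pos_form G -> (mform G v v == 0) = (v == 0).
Proof.
move=> [_ Gp]; have [->|v0] := eqVneq v 0; first by rewrite mform0l eqxx.
by apply/negbTE; rewrite gt_eqF// Gp.
Qed.

(** The form is nonnegative at <v,v> u - <u,v> v, and its value there is
    <v,v> (<u,u> <v,v> - <u,v>^2). *)
Lemma cauchy_schwarz G u v : pos_form G ->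
  `|mform G u v| <= Num.sqrt (mform G u u) * Num.sqrt (mform G v v).
Proof.
move=> Gp; have [Gs _] := Gp.
have [->|v0] := eqVneq v 0.
  by rewrite mform_sym// mform0l normr0 mulr_ge0 ?sqrtr_ge0.
have vv : 0 < mform G v v by rewrite lt_neqAle eq_sym pos_form_eq0// v0 pos_form_ge0.
rewrite -sqrtrM ?pos_form_ge0// -sqrtr_sqr ler_wsqrtr//.
have := pos_form_ge0 (mform G v v *: u + (- mform G u v) *: v) Gp.
rewrite !(mformDl, mformDr, mformZl, mformZr) (mform_sym v u Gs).
set a := mform G u u; set b := mform G u v; set d := mform G v v.
rewrite (_ : _ + _ = d * (a * d - b ^+ 2)); last by ring.
by rewrite pmulr_rge0// subr_ge0.
Qed.

Lemma pos_form_unit G : pos_form G -> G \in unitmx.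
Proof.
move=> [_ Gp]; rewrite -row_free_unit -kermx_eq0; apply/rowV0P => v.
move=> /sub_kermxP vG; apply/eqP; apply: contraT => /Gp.
by rewrite /mform vG mul0mx mxE ltxx.
Qed.

Lemma continuous_mform (T : topologicalType) (G : T -> 'M[R]_n) (u v : T -> 'rV[R]_n) t :
  {for t, continuous G} -> {for t, continuous u} -> {for t, continuous v} ->
  {for t, continuous (fun s => mform (G s) (u s) (v s))}.
Proof.
move=> cG cu cv.
have coord m1 m2 (F : T -> 'M[R]_(m1, m2)) i j :
    {for t, continuous F} -> {for t, continuous (fun s => F s i j)}.
  move=> cF; apply: (@continuous_comp _ _ _ F (fun M : 'M[R]_(m1, m2) => M i j)) => //.
  exact: coord_continuous.
rewrite (_ : (fun _ => _) = fun s => \sum_j (\sum_i u s 0 i * G s i j) * v s 0 j); last first.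
  by apply/funext => s; rewrite mformE.
apply: cvg_big => [|j _]; first exact: add_continuous.
apply: (@continuousM _ _ (fun s => \sum_i u s 0 i * G s i j)); last exact: coord.
apply: cvg_big => [|i _]; first exact: add_continuous.
by apply: (@continuousM _ _ (fun s => u s 0 i)); exact: coord.
Qed.

End BilinearForms.

(** * Length of curves and smooth functions *)
Section Paths.
Variables (R : realType) (n : nat) (M : riemannianManifold R n).
Implicit Types (x y : M) (i : chart_index M) (u v z : 'rV[R]_n).

Lemma metric_pos_form i z : chart_cod i z -> pos_form (metric i z).
Proof. by move=> cz; split; [exact: Defs.metric_sym|move=> v; exact: metric_pos]. Qed.

Lemma chart_cod_chart i x : chart_dom i x -> chart_cod i (chart i x).
Proof. by move=> dx; exists x. Qed.

Lemma chart_inv_dom i z : chart_cod i z -> chart_dom i (chart_inv i z).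
Proof. by move=> [x dx <-]; rewrite chartK. Qed.

Lemma chart_invK i z : chart_cod i z -> chart i (chart_inv i z) = z.
Proof. by move=> [x dx <-]; rewrite chartK. Qed.

Definition chart_norm i z v : R := Num.sqrt (mform (metric i z) v v).

Definition smooth_fun (u : M -> R) :=
  forall i, smooth_on (chart_cod i) (u \o chart_inv i : 'rV[R]_n -> R^o).

(** The dual norm of the differential of [u] at [x] is at most [L]; it is
    quantified over all charts so as to apply directly to a piece of a curve
    written in any of them. *)
Definition deriv_le (u : M -> R) x (L : R) := forall i v, chart_dom i x ->
  `|'D_v (u \o chart_inv i : 'rV[R]_n -> R^o) (chart i x)| <=
    L * chart_norm i (chart i x) v.

Lemma continuous_speed i (c : R -> 'rV[R]_n) t : C1_curve c -> chart_cod i (c t) ->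
  {for t, continuous (fun s => chart_norm i (c s) (derive1 c s))}.
Proof.
move=> [dc cc] cit.
apply: (@continuous_comp _ _ _ (fun s => mform (metric i (c s)) (derive1 c s) (derive1 c s)) Num.sqrt);
  last exact: sqrt_continuous.
apply: continuous_mform; try exact: cc.
apply: (@continuous_comp _ _ _ c (metric i)).
  exact/differentiable_continuous/derivable1_diffP.
exact: (smooth_on_continuous (@metric_smooth _ _ M i) cit).
Qed.

Lemma unit_within (f : R -> R) :
  (forall t, 0 <= t <= 1 -> {for t, continuous f}) -> {within `[0, 1], continuous f}.
Proof.
move=> cf; apply: continuous_in_subspaceT => t.
by rewrite inE /= in_itv /=; exact: cf.
Qed.

Lemma unit_integrable (f : R -> R) :
  (forall t, 0 <= t <= 1 -> {for t, continuous f}) ->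
  lebesgue_measure.-integrable `[0%R, 1%R] (EFin \o f).
Proof.
move=> cf; apply: continuous_compact_integrable; first exact: segment_compact.
exact: unit_within.
Qed.

(** By the fundamental theorem of calculus, the variation of [u] along the
    piece is the integral of du(c'), which is at most L times the speed. *)
Lemma piece_lipschitz (u : M -> R) L i c : smooth_fun u ->
  (forall x, deriv_le u x L) -> C1_curve c ->
  (forall t, 0 <= t <= 1 -> chart_cod i (c t)) ->
  `|u (chart_inv i (c 1)) - u (chart_inv i (c 0))| <= L * curve_length i c.
Proof.
move=> su uL Cc ci; have [dc cc] := Cc.
pose U := u \o chart_inv i.
pose f t : R := \sum_j derive1 c t 0 j * 'D_(basis_vec R j) (U : 'rV[R]_n -> R^o) (c t).
have oi := @chart_cod_open _ _ M i.
have dU (t : R) : 0 <= t <= 1 -> is_derive t 1 (U \o c : R -> R) (f t).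
  move=> t01; have cit := ci t t01.
  rewrite /f -(smooth_on_derive_sum _ oi (su i) cit).
  exact: smooth_on_curve oi (su i) cit (dc t).
have cf (t : R) : 0 <= t <= 1 -> {for t, continuous f}.
  move=> t01; apply: cvg_big => [|j _]; first exact: add_continuous.
  apply: (@continuousM _ _ (fun s => derive1 c s 0 j)).
    apply: (@continuous_comp _ _ _ (derive1 c) (fun v : 'rV[R]_n => v 0 j)); first exact: cc.
    exact: coord_continuous.
  apply: (@continuous_comp _ _ _ c ('D_(basis_vec R j) (U : 'rV[R]_n -> R^o))); first exact/differentiable_continuous/derivable1_diffP.
  exact: (smooth_on_continuous (smooth_on_derive _ (su i)) (ci t t01)).
have cUc (t : R) : 0 <= t <= 1 -> {for t, continuous (U \o c : R -> R)}.
  move=> t01; have [dUt _] := dU t t01.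
  exact/differentiable_continuous/derivable1_diffP.
have FTC : (\int[lebesgue_measure]_(t in `[0%R, 1%R]) f t = U (c 1) - U (c 0))%R.
  rewrite /Rintegral (@continuous_FTC2 _ f (U \o c : R -> R)) //.
  - exact: unit_within.
  - split.
    + by move=> t /subset_itv_oo_cc; rewrite in_itv /= => /dU[].
    + by apply: cvg_at_right_filter; apply: cUc; rewrite lexx ler01.
    + by apply: cvg_at_left_filter; apply: cUc; rewrite lexx ler01.
  - move=> t /subset_itv_oo_cc; rewrite in_itv /= => /dU[_ <-].
    by rewrite derive1E.
rewrite -FTC.
have cs (t : R) : 0 <= t <= 1 -> {for t, continuous (fun s => chart_norm i (c s) (derive1 c s))}.
  by move=> t01; apply: continuous_speed => //; exact: ci.
apply: le_trans (@le_normr_Rintegral _ _ _ lebesgue_measure _ f (measurable_itv _)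
  (unit_integrable cf)) _.
rewrite /curve_length -RintegralZl//; last exact: unit_integrable.
apply: le_Rintegral => //.
- by apply: unit_integrable => t t01; apply: continuous_comp; [exact: cf|exact: norm_continuous].
- apply: unit_integrable => t t01; apply: (@continuousM _ _ (cst L)); last exact: cs.
  exact: cst_continuous.
- move=> t /=; rewrite in_itv /= => t01; have cit := ci t t01.
  rewrite /f -(smooth_on_derive_sum _ oi (su i) cit).
  have := uL _ i (derive1 c t) (chart_inv_dom cit).
  by rewrite chart_invK.
Qed.

Lemma path_lipschitz (u : M -> R) L x y l : smooth_fun u ->
  (forall x, deriv_le u x L) -> C1_path_length x y l -> `|u y - u x| <= L * l.
Proof.
move=> su uL; elim=> [|{}y {}l i c _ IH Cc ci cy].
  by rewrite subrr normr0 mulr0.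
have := piece_lipschitz su uL Cc ci; rewrite cy => H.
rewrite mulrDr (addrC (L * l)); apply: le_trans (lerD H IH).
by apply: le_trans (ler_normD _ _); rewrite addrA subrK.
Qed.

End Paths.

(** * The geodesic distance *)
Section Distance.
Variables (R : realType) (n : nat) (M : riemannianManifold R n).
Implicit Types (x y z : M) (i : chart_index M).

Lemma path_cat x y z l k : C1_path_length x y l -> C1_path_length y z k ->
  C1_path_length x z (l + k).
Proof.
move=> xy; elim=> [|{}z {}k i c _ IH Cc ci cz]; first by rewrite addr0.
by rewrite addrA; exact: C1_path_rcons IH Cc ci cz.
Qed.

Lemma path_piece i (c : R -> 'rV[R]_n) : C1_curve c ->
  (forall t, 0 <= t <= 1 -> chart_cod i (c t)) ->
  C1_path_length (chart_inv i (c 0)) (chart_inv i (c 1) : M) (curve_length i c).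
Proof.
move=> Cc ci; rewrite -[curve_length i c]add0r.
by apply: C1_path_rcons => //; exact: C1_path_nil.
Qed.

Lemma derive1_comp_onem (c : R -> 'rV[R]_n) t : derivable c (1 - t) 1 ->
  derivable (fun t : R => c (1 - t)) t 1 /\
  derive1 (fun t : R => c (1 - t)) t = - derive1 c (1 - t).
Proof.
move=> /derivable1_diffP dc.
have d1 : is_diff t (fun t : R => 1 - t : R) (-%R).
  by apply: (is_diff_eq (is_diffB (is_diff_cst (1 : R) t) (is_diff_id t))); rewrite sub0r.
have dt : differentiable (fun t : R => 1 - t : R) t by case: d1.
have dco : differentiable (c \o (fun t : R => 1 - t)) t by exact: differentiable_comp.
split; first exact/derivable1_diffP.
rewrite derive1E' // diff_comp//= diff_val /= derive1E'//.
by rewrite linearN.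
Qed.

(** Reversal of curves gives the symmetry of the distance, which its
    definition by oriented curves does not show. *)
Lemma C1_curve_rev (c : R -> 'rV[R]_n) : C1_curve c -> C1_curve (fun t => c (1 - t)).
Proof.
move=> [dc cc]; split=> [t|]; first by have [] := derive1_comp_onem (dc (1 - t)).
rewrite (_ : derive1 _ = fun t => - derive1 c (1 - t)); last first.
  by apply/funext => t; have [] := derive1_comp_onem (dc (1 - t)).
move=> t.
apply: (@continuous_comp _ _ _ (fun t : R => derive1 c (1 - t)) (fun v : 'rV[R]_n => - v)); last exact: opp_continuous.
apply: (@continuous_comp _ _ _ (fun t : R => 1 - t) (derive1 c)); last exact: cc.
by apply: continuousB; [exact: cst_continuous|exact: cvg_id].
Qed.

Lemma curve_length_rev i (c : R -> 'rV[R]_n) : C1_curve c ->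
  (forall t, 0 <= t <= 1 -> chart_cod i (c t)) ->
  curve_length i (fun t => c (1 - t)) = @curve_length R n M i c.
Proof.
move=> Cc ci; pose s t := chart_norm i (c t) (derive1 c t).
have cs : {within `[0%R, 1%R], continuous s}.
  by apply: unit_within => t t01; apply: continuous_speed => //; exact: ci.
have r01 : 0 <= (1 : R) <= 1 by rewrite ler01 lexx.
have E := Rintegration_by_substitution_onem r01 cs.
rewrite -[RHS]/(\int[lebesgue_measure]_(t in `[0, 1]) s t)%R E [unstable.onem 1]subrr /curve_length.
apply: eq_Rintegral => t _.
have [dc _] := Cc; have [_ ->] := derive1_comp_onem (dc (1 - t)).
rewrite -[X in Num.sqrt X]/(mform (metric i (c (1 - t))) (- derive1 c (1 - t)) (- derive1 c (1 - t))).
by rewrite mformNN.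
Qed.

Lemma path_rev x y l : C1_path_length x y l -> C1_path_length y x l.
Proof.
elim=> [|{}y {}l i c _ IH Cc ci cy]; first exact: C1_path_nil.
rewrite addrC; apply: path_cat IH.
have := @path_piece i _ (C1_curve_rev Cc).
rewrite subr0 subrr cy curve_length_rev//; apply.
by move=> t /andP[t0 t1]; apply: ci; rewrite subr_ge0 t1 lerBlDr lerDl t0.
Qed.

(** A segment in a chart bounds the distance between its endpoints from above;
    this is the only explicit curve that is needed. *)
Lemma path_line i (a b : 'rV[R]_n) (C : R) :
  (forall t : R, 0 <= t <= 1 -> chart_cod i (t *: (b - a) + a)) ->
  (forall t : R, 0 <= t <= 1 -> chart_norm i (t *: (b - a) + a) (b - a) <= C) ->
  exists2 l, l <= C & C1_path_length (chart_inv i a) (chart_inv i b : M) l.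
Proof.
move=> ci cC; pose c (t : R) : 'rV[R]_n := t *: (b - a) + a.
have dc (t : R) : is_derive t 1 (c : R -> 'rV[R]_n) (b - a).
  have := is_derive_line (@derivable_id R 'rV[R]_n (t *: (b - a) + a) (b - a)).
  by rewrite derive_id.
have c'E : derive1 c = cst (b - a).
  by apply/funext => t; rewrite derive1E; have [_ ->] := dc t.
have Cc : C1_curve c.
  by split=> [t|]; [have [] := dc t|rewrite c'E; exact: cst_continuous].
exists (curve_length i c); last first.
  have := path_piece Cc ci.
  by rewrite /c scale0r add0r scale1r subrK.
have cst_int : lebesgue_measure.-integrable `[0%R, 1%R] (EFin \o cst C).
  by apply: unit_integrable => t _; exact: cst_continuous.
rewrite /curve_length.
apply: le_trans (@le_Rintegral _ _ _ lebesgue_measure `[0%R, 1%R] _ (cst C) _ _ _ _) _ => //.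
- by apply: unit_integrable => t t01; apply: continuous_speed => //; exact: ci.
- by move=> t /=; rewrite in_itv /= => /cC; rewrite c'E.
- rewrite Rintegral_cst// (_ : fine _ = 1) ?mulr1//.
  have := @lebesgue_measure_itv R `[0%R, 1%R]%R.
  rewrite /= lte_fin ltr01 oppr0 adde0 => H.
  transitivity (fine (1%:E : \bar R)) => //; congr fine; exact: H.
Qed.

Lemma geodesic_ballP x r y :
  geodesic_ball x r y <-> exists2 l, C1_path_length x y l & l < r.
Proof.
rewrite /geodesic_ball /= /geodesic_dist; split.
  move=> /ereal_inf_lt[_ [l xyl <-]]; rewrite lte_fin => lr.
  by exists l.
move=> [l xyl lr]; apply: (@le_lt_trans _ _ l%:E); last by rewrite lte_fin.
by apply: ereal_inf_lbound; exists l.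
Qed.

Lemma gball_center x r : 0 < r -> geodesic_ball x r x.
Proof. by move=> r0; apply/geodesic_ballP; exists 0 => //; exact: C1_path_nil. Qed.

Lemma gball_sym x y r : geodesic_ball x r y -> geodesic_ball y r x.
Proof.
by move=> /geodesic_ballP[l xy lr]; apply/geodesic_ballP; exists l => //; exact: path_rev.
Qed.

Lemma gball_trans x y z r s : geodesic_ball x r y -> geodesic_ball y s z ->
  geodesic_ball x (r + s) z.
Proof.
move=> /geodesic_ballP[l xy lr] /geodesic_ballP[k yz ks].
by apply/geodesic_ballP; exists (l + k); [exact: path_cat xy yz|exact: ltrD].
Qed.

Lemma gball_le x r s : r <= s -> geodesic_ball x r `<=` geodesic_ball x s.
Proof.
move=> rs y /geodesic_ballP[l xy lr]; apply/geodesic_ballP; exists l => //.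
exact: lt_le_trans rs.
Qed.

Lemma gball_lipschitz (u : M -> R) L x y r : smooth_fun u -> 0 < L ->
  (forall x, deriv_le u x L) -> geodesic_ball x r y -> `|u y - u x| < L * r.
Proof.
move=> su L0 uL /geodesic_ballP[l xy lr].
by apply: le_lt_trans (path_lipschitz su uL xy) _; rewrite ltr_pM2l.
Qed.

End Distance.

(** * Comparison of quadratic forms by compactness of the sphere *)
Section Sphere.
Variables (R : realType) (n : nat).
Implicit Types (u v : 'rV[R]_n) (G : 'M[R]_n).

Lemma compact_sphere : compact [set v : 'rV[R]_n | `|v| = 1].
Proof.
apply: bounded_closed_compact.
  by exists 1; split=> // x x1 v /= ->; exact: ltW.
rewrite (_ : [set v | _] = Num.norm @^-1` [set (1 : R)]) //.
apply: preimage_closed; first by move=> v _; exact: norm_continuous.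
exact: closed_eq.
Qed.

(** By compactness, a property that holds locally around each unit vector for
    small parameters holds on the whole sphere for small parameters. *)
Lemma near_sphere (I : Type) (F : set_system I) (P : I -> 'rV[R]_n -> Prop) :
  Filter F -> (forall v, `|v| = 1 -> \forall v' \near v & i \near F, P i v') ->
  \forall i \near F, forall v, `|v| = 1 -> P i v.
Proof.
by move=> FF H; have /compact_near_coveringP/(_ I F P FF) := compact_sphere; apply.
Qed.

Lemma unit_direction v : v != 0 ->
  exists2 u, `|u| = 1 & v = `|v| *: u.
Proof.
move=> v0; have nv : `|v| != 0 by rewrite normr_eq0.
exists (`|v|^-1 *: v); last by rewrite scalerA divff// scale1r.
by rewrite normrZ normfV normr_id mulVf.
Qed.

(** Equivalence of norms: sqrt(G(v,v)) is continuous and positive on the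
    sphere, hence bounded below there, and homogeneity does the rest. *)
Lemma mform_norm_lower G : pos_form G ->
  exists2 l : R, 0 < l & forall v, l * `|v| <= Num.sqrt (mform G v v).
Proof.
move=> Gp.
have H : \forall e \near (0 : R)^'+, forall v, `|v| = 1 -> e <= Num.sqrt (mform G v v).
  apply: near_sphere => v v1.
  have sv : 0 < Num.sqrt (mform G v v).
    rewrite sqrtr_gt0 lt_neqAle eq_sym pos_form_eq0// pos_form_ge0// andbT.
    by rewrite -normr_eq0 v1 oner_eq0.
  have cs : {for v, continuous (fun w : 'rV[R]_n => Num.sqrt (mform G w w))}.
    apply: (@continuous_comp _ _ _ (fun w : 'rV[R]_n => mform G w w) Num.sqrt); last exact: sqrt_continuous.
    by apply: continuous_mform; [exact: cst_continuous|exact: cvg_id|exact: cvg_id].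
  have s2 : Num.sqrt (mform G v v) / 2 < Num.sqrt (mform G v v) by rewrite ltr_pdivrMr// mulr2n mulrDr mulr1 ltrDl.
  have A := cvgr_gt _ cs _ s2.
  have B : \forall e \near (0:R)^'+, e <= Num.sqrt (mform G v v) / 2.
    by apply: nbhs_right_le; rewrite divr_gt0.
  near=> w e => /=.
  apply: (@le_trans _ _ (Num.sqrt (mform G v v) / 2)); first by near: e.
  by apply: ltW; near: w; exact: A.
near (0:R)^'+ => l.
have l0 : 0 < l by near: l; exact: nbhs_right_gt.
exists l => // v.
have [->|v0] := eqVneq v 0; first by rewrite normr0 mulr0 sqrtr_ge0.
have [u u1 vE] := unit_direction v0.
rewrite {2 3}vE mformZl mformZr mulrA -expr2 sqrtrM ?sqr_ge0// sqrtr_sqr ger0_norm//.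
rewrite mulrC ler_wpM2l//.
by move: u u1 {vE}; near: l.
Unshelve. all: by end_near. Qed.

(** The ratio of the quadratic forms at z and z0 tends to 1 uniformly on the
    sphere.  A factor 4 on the squares is a factor 2 on the norms. *)
Lemma mform_near_comparable (g : 'rV[R]_n -> 'M[R]_n) z0 :
  {for z0, continuous g} -> pos_form (g z0) ->
  \forall z \near z0, forall v,
    mform (g z) v v <= 4 * mform (g z0) v v /\
    mform (g z0) v v <= 4 * mform (g z) v v.
Proof.
move=> cg Gp.
have : \forall z \near z0, forall v, `|v| = 1 ->
  mform (g z) v v <= 4 * mform (g z0) v v /\ mform (g z0) v v <= 4 * mform (g z) v v.
  apply: (@near_sphere _ (nbhs z0) (fun z v => mform (g z) v v <= 4 * mform (g z0) v v /\
    mform (g z0) v v <= 4 * mform (g z) v v)) => v v1.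
  have sv : 0 < mform (g z0) v v.
    rewrite lt_neqAle eq_sym pos_form_eq0// pos_form_ge0// andbT.
    by rewrite -normr_eq0 v1 oner_eq0.
  have c1 : {for (v, z0), continuous (fun w : 'rV[R]_n * 'rV[R]_n => mform (g w.2) w.1 w.1)}.
    apply: continuous_mform; try exact: cvg_fst.
    by apply: (@continuous_comp _ _ _ snd g); [exact: cvg_snd|exact: cg].
  have c2 : {for (v, z0), continuous (fun w : 'rV[R]_n * 'rV[R]_n => mform (g z0) w.1 w.1)}.
    by apply: continuous_mform; try exact: cvg_fst; exact: cst_continuous.
  have d1 : {for (v, z0), continuous (fun w : 'rV[R]_n * 'rV[R]_n =>
      4 * mform (g z0) w.1 w.1 - mform (g w.2) w.1 w.1)}.
    by apply: continuousB => //; apply: continuousM => //; exact: cst_continuous.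
  have d2 : {for (v, z0), continuous (fun w : 'rV[R]_n * 'rV[R]_n =>
      4 * mform (g w.2) w.1 w.1 - mform (g z0) w.1 w.1)}.
    by apply: continuousB => //; apply: continuousM => //; exact: cst_continuous.
  have p0 : 0 < 4 * mform (g z0) v v - mform (g z0) v v by lra.
  have A := cvgr_gt _ d1 _ p0.
  have B := cvgr_gt _ d2 _ p0.
  have C : \forall w \near (v, z0), mform (g w.2) w.1 w.1 <= 4 * mform (g z0) w.1 w.1 /\
     mform (g z0) w.1 w.1 <= 4 * mform (g w.2) w.1 w.1.
    near=> w; split; rewrite -subr_ge0 ltW//; near: w; [exact: A|exact: B].
  exact: C.
apply: filterS => z H v.
have [->|v0] := eqVneq v 0; first by rewrite !mform0l mulr0 lexx.
have [u u1 vE] := unit_direction v0.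
have [H1 H2] := H u u1.
rewrite vE !mformZl !mformZr.
by rewrite !(mulrCA 4) !ler_wpM2l.
Unshelve. all: by end_near. Qed.

Lemma is_derive_mform (V : normedModType R) G (f : V -> 'rV[R]_n) y w :
  derivable f y w ->
  is_derive y w (fun z => mform G (f z) (f z) : R)
    (mform G ('D_w f y) (f y) + mform G (f y) ('D_w f y)).
Proof.
move=> df.
have dj j : is_derive y w (fun z => f z 0 j : R) ('D_w f y 0 j) by exact: is_derive_coord.
have Di j : is_derive y w (\sum_i (G i j \*: (fun z => f z 0 i : R^o)) : V -> R^o)
    (\sum_i (G i j * 'D_w f y 0 i)).
  by apply: is_derive_sum => i; exact: is_deriveZ.
have Dj : is_derive y w (\sum_j ((\sum_i (G i j \*: (fun z => f z 0 i : R^o)) : V -> R)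
     * (fun z => f z 0 j : R)) : V -> R^o)
    (\sum_j ((\sum_i G i j * f y 0 i) * 'D_w f y 0 j + f y 0 j * (\sum_i G i j * 'D_w f y 0 i))).
  apply: is_derive_sum => j; apply: (is_derive_eq (is_deriveM (Di j) (dj j))).
  by rewrite fct_sumE.
have E : (fun z => mform G (f z) (f z) : R) = (\sum_j ((\sum_i (G i j \*: (fun z => f z 0 i : R^o)) : V -> R)
     * (fun z => f z 0 j : R)) : V -> R^o).
  apply/funext => z; rewrite mformE fct_sumE; apply: eq_bigr => j _ /=.
  rewrite -[RHS]/(_ * _) fct_sumE; congr (_ * _); apply: eq_bigr => i _.
  by rewrite mulrC.
rewrite E; apply: (is_derive_eq Dj).
rewrite !mformE big_split addrC /=; congr (_ + _); apply: eq_bigr => j _.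
  by congr (_ * _); apply: eq_bigr => i _; exact: mulrC.
by rewrite mulrC; congr (_ * _); apply: eq_bigr => i _; exact: mulrC.
Qed.

Lemma smooth_on_mform m (U : set 'rV[R]_m) G (f : 'rV[R]_m -> 'rV[R]_n) : open U ->
  smooth_on U f -> smooth_on U (fun z => mform G (f z) (f z) : R^o).
Proof.
move=> oU sf.
have S i j : smooth_on U (fun z => G i j * f z 0 i : R^o).
  exact: smooth_onM oU (smooth_on_cst _ oU) (smooth_on_coord i oU sf).
have H j : smooth_on U (fun z => (\sum_(i <- enum 'I_n) (G i j * f z 0 i)) * f z 0 j : R^o).
  apply: (smooth_onM oU _ (smooth_on_coord j oU sf)).
  by apply: smooth_on_sum => // i; exact: S.
apply: smooth_on_eq (smooth_on_sum (enum 'I_n) oU H) => // y _; rewrite mformE big_enum; apply: eq_bigr => j _.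
by rewrite big_enum; congr (_ * _); apply: eq_bigr => i _; rewrite mulrC.
Qed.

End Sphere.

(** * Bump functions in charts *)
Section Bump.
Variables (R : realType) (n : nat) (M : riemannianManifold R n).
Implicit Types (p q x : M) (i : chart_index M) (v : 'rV[R]_n) (e l d : R).

(** The norm obtained by freezing, in the preferred chart around [p], the metric
    at its value at [p]. *)
Definition frame_norm p v : R := chart_norm (chart_at p) (chart (chart_at p) p) v.

(** On the coordinate ball of radius [e] around [p], the metric and the frozen one
    agree up to a factor 2, and [l] compares the latter with the norm of
    coordinates. *)
Definition frame_scale p e l :=
  [/\ 0 < e, 0 < l,
    forall z, `|z - chart (chart_at p) p| < e -> chart_cod (chart_at p) z,
    forall z v, `|z - chart (chart_at p) p| < e ->
      chart_norm (chart_at p) z v <= 2 * frame_norm p v /\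
      frame_norm p v <= 2 * chart_norm (chart_at p) z v &
    forall v, l * `|v| <= frame_norm p v].

Lemma frame_scale_exists p : exists e l, frame_scale p e l.
Proof.
set a := chart_at p; set o := chart a p.
have ao : chart_cod a o by apply: chart_cod_chart; exact: mem_chart_at.
have Gp : pos_form (metric a o) by exact: metric_pos_form.
have [l l0 Hl] := mform_norm_lower Gp.
have cg : {for o, continuous (metric a)}.
  exact: (smooth_on_continuous (@metric_smooth _ _ M a) ao).
have H1 := mform_near_comparable cg Gp.
have H2 : \forall z \near o, chart_cod a z := open_near (@chart_cod_open _ _ M a) ao (fun=> id).
have [e /= e0 He] := (nbhs_ballP _ _).1 (filterI H2 H1).
have {}He z : `|z - o| < e -> chart_cod a z /\
    forall v, mform (metric a z) v v <= 4 * mform (metric a o) v v /\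
    mform (metric a o) v v <= 4 * mform (metric a z) v v.
  by move=> zo; apply: He; rewrite -ball_normE /ball_ /= distrC.
exists e, l; split=> //.
- by move=> z /He[].
- move=> z v /He[_ /(_ v)[A B]]; rewrite /frame_norm /chart_norm.
  have s4 : 2 = Num.sqrt 4 :> R by rewrite (_ : 4 = 2 ^+ 2) ?sqrtr_sqr ?ger0_norm// expr2 -natrM.
  by rewrite s4 -!sqrtrM// !ler_wsqrtr.
Qed.

Lemma frame_form p : pos_form (metric (chart_at p) (chart (chart_at p) p)).
Proof. by apply: metric_pos_form; apply: chart_cod_chart; exact: mem_chart_at. Qed.

Lemma frame_normZ p a v : frame_norm p (a *: v) = `|a| * frame_norm p v.
Proof.
by rewrite /frame_norm /chart_norm mformZl mformZr mulrA -expr2 sqrtrM ?sqr_ge0// sqrtr_sqr.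
Qed.

Lemma frame_norm_ge0 p v : 0 <= frame_norm p v.
Proof. exact: sqrtr_ge0. Qed.

Lemma frame_norm_sqr p v :
  frame_norm p v ^+ 2 = mform (metric (chart_at p) (chart (chart_at p) p)) v v.
Proof. by rewrite sqr_sqrtr// pos_form_ge0//; exact: frame_form. Qed.

(** The bump around [q] is computed with the metric frozen at [p] and not
    at [q]: this is what gives bounds uniform for [q] near [p].  It is
    normalised to be 1 at [q]. *)
Definition bump p q d x : R :=
  if `[< chart_dom (chart_at p) x >] then
    expR 1 * flat 0 (1 - d ^- 2 * mform (metric (chart_at p) (chart (chart_at p) p))
       (chart (chart_at p) x - chart (chart_at p) q)
       (chart (chart_at p) x - chart (chart_at p) q))
  else 0.

Section BumpTheory.
Variables (p q : M) (e l d : R).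
Hypothesis scale : frame_scale p e l.
Hypothesis q_dom : chart_dom (chart_at p) q.
Hypothesis q_near : `|chart (chart_at p) q - chart (chart_at p) p| < e / 2.
Hypothesis d_gt0 : 0 < d.
Hypothesis d_small : d < l * (e / 2).

Local Notation a := (chart_at p).
Local Notation o := (chart a p).
Local Notation zq := (chart a q).
Local Notation G := (metric a o).
Local Notation b := (bump p q d).
Local Notation N := (frame_norm p).

Lemma frame_ball_near z : N (z - zq) <= d -> `|z - o| < e.
Proof.
have [e0 l0 _ _ Hl] := scale => zd.
have : l * `|z - zq| < l * (e / 2) by rewrite (le_lt_trans (Hl _))// (le_lt_trans zd).
rewrite ltr_pM2l// => zq2.
rewrite -(subrK zq z) -addrA (le_lt_trans (ler_normD _ _))//.
by rewrite [ltRHS](splitr e) ltrD.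
Qed.

Lemma bump01 x : 0 <= b x <= 1.
Proof.
rewrite /bump; case: asboolP => _; last by rewrite lexx ler01.
rewrite mulr_ge0 ?flat_ge0 ?expR_ge0//=.
set u := 1 - _; have u1 : u <= 1.
  by rewrite /u lerBlDr lerDl mulr_ge0// ?invr_ge0 ?sqr_ge0// pos_form_ge0//; exact: frame_form.
rewrite /flat; case: ifP => u0; last by rewrite mulr0.
rewrite expr0 mul1r -expRD -[leRHS]expR0 ler_expR subr_le0.
by rewrite -[leLHS]invr1 lef_pV2 ?posrE.
Qed.

Lemma bump_center : b q = 1.
Proof.
rewrite /bump asboolT// subrr mform0l mulr0 subr0 /flat ltr01 invr1 expr0 mul1r.
by rewrite -expRD addrN expR0.
Qed.

Lemma flat_neq0_norm z m : flat m (1 - d ^- 2 * mform G (z - zq) (z - zq)) != 0 ->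
  N (z - zq) < d.
Proof.
rewrite /flat; case: ifP => [|_ /eqP//]; rewrite subr_gt0 mulrC ltr_pdivrMr ?exprn_gt0// mul1r => H _.
by rewrite -(ltr_pXn2r (n := 2)) ?nnegrE ?frame_norm_ge0 ?ltW// frame_norm_sqr.
Qed.

Lemma bump_neq0 x : b x != 0 -> chart_dom a x /\ N (chart a x - zq) < d.
Proof.
rewrite /bump; case: asboolP => [xa|_ /eqP//]; rewrite mulf_eq0 negb_or => /andP[_ H].
by split=> //; exact: flat_neq0_norm H.
Qed.

(** The segment from [q] to [x] in the chart stays in the region where the
    metric is at most twice the frozen norm. *)
Lemma bump_support_ball x : b x != 0 -> geodesic_ball q (2 * d) x.
Proof.
move=> /bump_neq0[xa xd]; apply/geodesic_ballP.
have [e0 l0 Hc Hn Hl] := scale.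
have zE (t : R) : 0 <= t <= 1 -> `|t *: (chart a x - zq) + zq - o| < e.
  move=> /andP[t0 t1]; apply: frame_ball_near.
  rewrite addrK frame_normZ ger0_norm// (le_trans _ (ltW xd))// ler_piMl//.
  exact: frame_norm_ge0.
have [//|t t01|k kC] := @path_line _ _ M a zq (chart a x) (2 * N (chart a x - zq)).
- by move=> t t01; apply: Hc; exact: zE.
- by have [] := Hn _ (chart a x - zq) (zE t t01).
rewrite !chartK// => pk; exists k => //.
by rewrite (le_lt_trans kC)// ltr_pM2l.
Qed.

Definition overlap i : set 'rV[R]_n := chart i @` (chart_dom i `&` chart_dom a).

Lemma open_chart_preimage i (U : set M) : open U ->
  open (chart_cod i `&` chart_inv i @^-1` U).
Proof.
move=> oU; rewrite openE => y [iy Uy].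
apply: filterI; first exact: open_near (@chart_cod_open _ _ M i) iy _.
apply: (@chart_inv_continuous _ _ M i y iy).
exact: open_nbhs_nbhs.
Qed.

Lemma overlapE i : overlap i = chart_cod i `&` chart_inv i @^-1` chart_dom a.
Proof.
apply/seteqP; split=> [y [x [ix ax] <-]|y [[x ix <-]]].
  by split; [exists x|rewrite /= chartK].
by rewrite /= chartK// => ax; exists x.
Qed.

Lemma open_overlap i : open (overlap i).
Proof. by rewrite overlapE; apply: open_chart_preimage; exact: chart_dom_open. Qed.

Lemma bump_overlap i y : overlap i y -> b (chart_inv i y) =
  expR 1 * flat 0 (1 - d ^- 2 * mform G ((chart a \o chart_inv i) y - zq) ((chart a \o chart_inv i) y - zq)).
Proof. by rewrite overlapE => -[iy ay]; rewrite /bump asboolT. Qed.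

(** A compact set containing the support of the bump.  Its closedness, for
    which the manifold has to be Hausdorff, ensures that extending the bump by
    0 outside the chart keeps it smooth. *)
Definition bump_compact : set M := chart_inv a @` [set z | N (z - zq) <= d].

Lemma closed_bump_compact : closed bump_compact.
Proof.
apply: compact_closed; first exact: carrier_hausdorff.
have [e0 l0 Hc Hn Hl] := scale.
have cN : continuous (fun z : 'rV[R]_n => N (z - zq)).
  move=> z; apply: (@continuous_comp _ _ _ (fun z : 'rV[R]_n => mform G (z - zq) (z - zq)) Num.sqrt); last exact: sqrt_continuous.
  have cs : {for z, continuous (fun z : 'rV[R]_n => z - zq)}.
    by apply: continuousB; [exact: cvg_id|exact: cst_continuous].
  by apply: continuous_mform => //; exact: cst_continuous.
apply: continuous_compact.
  apply: continuous_in_subspaceT => z; rewrite inE /= => zd.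
  by apply: chart_inv_continuous; apply: Hc; exact: frame_ball_near.
apply: bounded_closed_compact.
  exists (`|o| + e); split; first by rewrite num_real.
  move=> m om z /= zd; rewrite (le_trans _ (ltW om))//.
  rewrite -(subrK o z) addrC (le_trans (ler_normD _ _))// lerD2l ltW//.
  exact: frame_ball_near.
rewrite (_ : [set z | _] = (fun z : 'rV[R]_n => N (z - zq)) @^-1` [set r | r <= d]) //.
by apply: preimage_closed; [move=> z _; exact: cN|exact: closed_le].
Qed.

Lemma bump_off x : ~ bump_compact x -> b x = 0.
Proof.
move=> xK; apply/eqP; apply: contraT => /bump_neq0[ax xd]; case: xK.
by exists (chart a x); [exact: ltW|rewrite chartK].
Qed.

(** In another chart, two open sets cover everything: the overlap with the chart
    at [p], where the bump has a formula, and the complement of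
    [bump_compact], where it vanishes. *)
Lemma bump_cases i y : chart_cod i y -> overlap i y \/
  (chart_cod i `&` chart_inv i @^-1` (~` bump_compact)) y.
Proof.
move=> iy; have [ya|ya] := pselect (chart_dom a (chart_inv i y)).
  by left; rewrite overlapE.
right; split=> //= -[z zd zE]; apply: ya; rewrite -zE.
have [_ _ Hc _ _] := scale.
by apply: chart_inv_dom; apply: Hc; exact: frame_ball_near.
Qed.

Lemma smooth_bump : smooth_fun b.
Proof.
move=> i; apply: smooth_on_local => y iy.
have [yo|yK] := bump_cases iy.
  exists (overlap i) => //.
  have oo := @open_overlap i.
  have sT : smooth_on (overlap i) (fun y => (chart a \o chart_inv i) y - zq).
    apply: (@smooth_on_coind _ _ _ _ (fun f => exists2 g : 'rV[R]_n -> 'rV[R]_n,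
       smooth_on (overlap i) g & exists z, f = fun y => g y - z)) => //; last first.
      by exists (chart a \o chart_inv i); [exact: transition_smooth|exists zq].
    move=> _ [g sg [z ->]]; split=> [w ow|v].
      by apply: continuousB; [exact: (smooth_on_continuous sg ow)|exact: cst_continuous].
    exists ('D_v g).
      exists ('D_v g); [exact: smooth_on_derive|exists 0].
      by apply/funext => w; rewrite subr0.
    move=> w ow; have dg := derivableP (smooth_on_derivable v sg ow).
    by apply: (is_derive_eq (is_deriveB dg (is_derive_cst z w v))); rewrite subr0.
  have := smooth_on_mform G oo sT.
  move=> /(smooth_on_affine 1 (- d ^- 2) oo)/(smooth_on_flat 0 oo)/(smooth_on_affine 0 (expR 1) oo).
  apply: smooth_on_eq => // w ow.
  by rewrite [RHS]/= bump_overlap// add0r /= mulNr.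
set V := _ `&` _ in yK; exists V => //.
have oV : open V by apply: open_chart_preimage; rewrite openC; exact: closed_bump_compact.
apply: smooth_on_eq (smooth_on_cst 0 oV) => // w [iw wK].
by rewrite /= bump_off.
Qed.

(** By the chain rule the differential is e flat'(1 - Q/d^2) 2 G(w, .) / d^2,
    where w is the coordinate vector from q, and it vanishes unless |w| < d.
    There, |G(w, v)| <= d |v| by Cauchy-Schwarz.  The numerical constant
    collects 4 for the flat function, 2 for the square, and 2 for the change
    from the frozen norm to the metric. *)
Lemma deriv_bump x : deriv_le b x (16 * expR 1 / d).
Proof.
move=> i v ix; set y := chart i x.
have iy : chart_cod i y by exact: chart_cod_chart.
have [yo|yK] := bump_cases iy; last first.
  set V := _ `&` _ in yK.
  have oV : open V by apply: open_chart_preimage; rewrite openC; exact: closed_bump_compact.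
  have nE : \forall w \near y, cst 0 w = (b \o chart_inv i) w.
    by apply: (open_near oV yK) => w [iw wK]; rewrite /= bump_off.
  rewrite -(near_eq_derive v nE) derive_cst normr0 !mulr_ge0 ?expR_ge0 ?sqrtr_ge0//.
  by rewrite invr_ge0 ltW.
pose T := chart a \o chart_inv i.
have sT : smooth_on (overlap i) T by exact: transition_smooth.
have dT : derivable T y v by exact: smooth_on_derivable sT yo.
have dTz : is_derive y v (fun y => T y - zq) ('D_v T y).
  by apply: (is_derive_eq (is_deriveB (derivableP dT) (is_derive_cst zq y v))); rewrite subr0.
have [dTz1 dTz2] := dTz.
have dQ := is_derive_mform G dTz1.
rewrite dTz2 in dQ.
set w := T y - zq in dQ.
have [Gs _] := frame_form p.
rewrite (mform_sym _ w Gs) in dQ.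
set Q' := mform G w ('D_v T y) in dQ.
have dq : is_derive y v (fun y => 1 - d ^- 2 * mform G (T y - zq) (T y - zq) : R) (- (d ^- 2 * (Q' + Q'))).
  apply: (is_derive_eq (is_deriveB (is_derive_cst (1 : R) y v) (is_deriveZ (d ^- 2) dQ))).
  by rewrite sub0r.
have df := is_deriveZ (expR 1) (is_derive_comp1 dq (is_derive_flat 0 _)).
have nE : \forall z \near y, (expR 1 \*: (flat 0 \o (fun y => 1 - d ^- 2 * mform G (T y - zq) (T y - zq)) : _ -> R^o)) z = (b \o chart_inv i) z.
  by apply: (open_near (@open_overlap i) yo) => z zo; rewrite [RHS]/= bump_overlap.
have [_ ->] := near_eq_is_derive nE df.
rewrite mul0r subr0 -/w.
have TyE : T y = chart a x by rewrite /T /y /= chartK.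
have xa : chart_dom a x by move: yo; rewrite overlapE => -[_]; rewrite /= chartK.
have [->|f0] := eqVneq (flat 2 (1 - d ^- 2 * mform G w w)) 0.
  rewrite mul0r scaler0 normr0 !mulr_ge0 ?expR_ge0 ?sqrtr_ge0//.
  by rewrite invr_ge0 ltW.
have wd : N w < d by exact: flat_neq0_norm f0.
have [e0 l0 Hc Hn Hl] := scale.
have [_ HN] := Hn _ ('D_v T y) (frame_ball_near (ltW wd)).
have QC : `|Q'| <= d * (2 * chart_norm i y v).
  apply: le_trans (cauchy_schwarz _ _ (frame_form p)) _.
  apply: ler_pM; rewrite ?sqrtr_ge0//; first exact: ltW.
  apply: (le_trans HN); rewrite TyE ler_wpM2l// /chart_norm ler_wsqrtr//.
  by rewrite /mform (metric_compat v v ix xa).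
rewrite [_ *: _]/(_ * _) !normrM (ger0_norm (expR_ge0 _)) (ger0_norm (flat_ge0 _ _)) normrN normrM.
rewrite (ger0_norm (x := d ^- 2)); last by rewrite invr_ge0 sqr_ge0.
have QQ : `|Q' + Q'| <= d * (4 * chart_norm i y v).
  by rewrite (le_trans (ler_normD _ _))//; lra.
have fl : flat 2 (1 - d ^- 2 * mform G w w) <= 4 by rewrite (le_trans (flat_le _ _))// -natrX.
have d0 : d != 0 by rewrite gt_eqF.
have -> : 16 * expR 1 / d * chart_norm i y v =
    expR 1 * (4 * (d ^- 2 * (d * (4 * chart_norm i y v)))) by field.
have d2 : 0 <= d ^- 2 by rewrite invr_ge0 sqr_ge0.
by rewrite ler_wpM2l ?expR_ge0// ler_pM ?flat_ge0 ?mulr_ge0// ler_wpM2l.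
Qed.
End BumpTheory.

Lemma near_frame p e : 0 < e -> \forall x \near p,
  chart_dom (chart_at p) x /\ `|chart (chart_at p) x - chart (chart_at p) p| < e.
Proof.
move=> e0; apply: filterI.
  exact: open_near (@chart_dom_open _ _ M _) (mem_chart_at p) _.
have /cvgr_distC_lt := @chart_continuous _ _ M _ _ (mem_chart_at p).
exact.
Qed.

Lemma smooth_fun_continuous (u : M -> R) : smooth_fun u -> continuous u.
Proof.
move=> su x; set a := chart_at x.
have ax : chart_dom a x by exact: mem_chart_at.
have cu : {for x, continuous ((u \o chart_inv a) \o chart a)}.
  apply: continuous_comp; first exact: (@chart_continuous _ _ M _ _ ax).
  exact: (smooth_on_continuous (su a) (chart_cod_chart ax)).
have nE : \forall y \near x, ((u \o chart_inv a) \o chart a) y = u y.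
  by apply: (open_near (@chart_dom_open _ _ M a) ax) => y ay; rewrite /= chartK.
rewrite /continuous_at -(nbhs_singleton nE).
exact: cvg_trans (near_eq_cvg nE) cu.
Qed.

Definition bump_lip : R := 32 * expR 1.

Lemma bump_lip_gt0 : 0 < bump_lip.
Proof. by rewrite mulr_gt0// expR_gt0. Qed.

(** The properties of a bump at scale [d], with its construction forgotten. *)
Definition bump_at q d (b : M -> R) :=
  [/\ smooth_fun b, forall x, 0 <= b x <= 1, b q = 1,
    forall x, deriv_le b x (bump_lip / d) &
    forall x, b x != 0 -> geodesic_ball q d x].

(** The scale is uniform near [p].  The bump is built at scale d/2, because
    its support is contained in the ball of twice the radius. *)
Lemma exists_bump p : exists2 r : R, 0 < r & \forall q \near p,
  forall d, 0 < d < r -> exists b, bump_at q d b.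
Proof.
have [e [l He]] := frame_scale_exists p; have [e0 l0 _ _ _] := He.
exists (l * (e / 2)); first by rewrite mulr_gt0// divr_gt0.
have e20 : 0 < e / 2 by rewrite divr_gt0.
apply: filterS (near_frame p e20) => q [qa qe] d /andP[d0 dr].
have d20 : 0 < d / 2 by rewrite divr_gt0.
have d2r : d / 2 < l * (e / 2) by rewrite (le_lt_trans _ dr)// ler_pdivrMr// ler_peMr ?ler1n// ltW.
exists (bump p q (d / 2)); split.
- exact: smooth_bump He qe d20 d2r.
- exact: bump01.
- exact: bump_center.
- move=> x; have := @deriv_bump p q e l _ He qe d20 d2r x.
  congr (deriv_le _ _ _); rewrite /bump_lip invf_div -mulrA [_ * (2 / d)]mulrA.
  by field; rewrite gt_eqF.
- move=> x /(bump_support_ball He qa qe d20 d2r).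
  by rewrite mulrCA divff// mulr1.
Qed.

(** A bump at [p] supported in the neighbourhood is Lipschitz for the
    distance, so it cannot drop from 1 to 0 within a small ball. *)
Lemma nbhs_gball p (V : set M) : nbhs p V ->
  exists2 r : R, 0 < r & geodesic_ball p r `<=` V.
Proof.
move=> pV; have [e [l He]] := frame_scale_exists p; have [e0 l0 Hc _ Hl] := He.
set a := chart_at p in Hc *; set o := chart a p in Hc.
have ap : chart_dom a p by exact: mem_chart_at.
have ci := @chart_inv_continuous _ _ M _ _ (chart_cod_chart ap).
have : \forall z \near o, V (chart_inv a z) by apply: ci; rewrite chartK.
move=> /nbhs_ballP[h /= h0 Hh].
pose d := l * (Num.min (e / 2) h / 2).
have m0 : 0 < Num.min (e / 2) h by rewrite lt_min h0 andbT divr_gt0.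
have d0 : 0 < d by rewrite mulr_gt0// divr_gt0.
have mlt : Num.min (e / 2) h / 2 < Num.min (e / 2) h.
  by rewrite ltr_pdivrMr// ltr_pMr// ltr1n.
have dr : d < l * (e / 2).
  by rewrite /d ltr_pM2l// (lt_le_trans mlt)// ge_min lexx.
have pe : `|chart a p - o| < e / 2 by rewrite subrr normr0 divr_gt0.
exists (d / (16 * expR 1)); first by rewrite divr_gt0// mulr_gt0// expR_gt0.
move=> x px; have L0 : 0 < 16 * expR 1 / d by rewrite divr_gt0// mulr_gt0// expR_gt0.
have := gball_lipschitz (smooth_bump He pe d0 dr) L0 (@deriv_bump p p e l _ He pe d0 dr) px.
rewrite bump_center// mulrA divfK ?gt_eqF// divff ?mulf_neq0 ?gt_eqF ?expR_gt0// => b1.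
have : bump p p d x != 0.
  by apply: contraTneq b1 => ->; rewrite sub0r normrN normr1 ltxx.
move=> /(bump_neq0 d0)[xa xd].
rewrite -(chartK xa); apply: Hh; rewrite -ball_normE /ball_ /= distrC.
rewrite -(ltr_pM2l l0) (le_lt_trans (Hl _))// (lt_trans xd)// /d ltr_pM2l//.
by rewrite (lt_le_trans mlt)// ge_min lexx orbT.
Qed.

(** A bump supported in the ball is continuous and positive at its centre. *)
Lemma gball_nbhs p r : 0 < r -> nbhs p (geodesic_ball p r).
Proof.
move=> r0; have [s s0 /nbhs_singleton/(_ (Num.min r s / 2))] := exists_bump p.
have m0 : 0 < Num.min r s by rewrite lt_min r0.
have mlt : Num.min r s / 2 < Num.min r s.
  by rewrite ltr_pdivrMr// ltr_pMr// ltr1n.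
case=> [|b [sb _ b1 _ bB]].
  by rewrite divr_gt0//= (lt_le_trans mlt)// ge_min lexx orbT.
have cb : b x @[x --> p] --> (1 : R) by rewrite -b1; exact: smooth_fun_continuous.
have : \forall x \near p, 0 < b x by apply: (cvgr_gt _ cb); exact: ltr01.
apply: filterS => x bx; apply: gball_le (bB x _); last by rewrite gt_eqF.
by rewrite (le_trans (ltW mlt))// ge_min lexx.
Qed.

Lemma open_gball p r : open (geodesic_ball p r).
Proof.
rewrite openE => x /geodesic_ballP[l pxl lr].
have s0 : 0 < r - l by rewrite subr_gt0.
apply: filterS (gball_nbhs x s0) => y /geodesic_ballP[k xyk kr].
apply/geodesic_ballP; exists (l + k); first exact: path_cat pxl xyk.
by rewrite addrC -ltrBrDr.
Qed.

Lemma closure_gball p r s (S : set M) : 0 < s -> S `<=` geodesic_ball p r ->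
  closure S `<=` geodesic_ball p (r + s).
Proof.
move=> s0 Sp y /(_ _ (gball_nbhs y s0))[z [/Sp pz yz]].
exact: (gball_trans pz (gball_sym yz)).
Qed.

End Bump.

(** * Integrals of functions that may fail to be measurable *)
Section InnerIntegral.
Context d (T : measurableType d) (R : realType).
Variable mu : {measure set T -> \bar R}.
Implicit Types f g : T -> \bar R.
Local Open Scope ereal_scope.
Import HBNNSimple.

(** The integral of a nonnegative function is by definition a supremum over
    simple functions below it, so it is monotone whether or not the functions
    are measurable. *)
Lemma le_integral_any f g : (forall x, 0 <= f x) -> (forall x, f x <= g x) ->
  \int[mu]_x f x <= \int[mu]_x g x.
Proof.
move=> f0 fg; have g0 x : 0 <= g x by exact: le_trans (f0 x) (fg x).
rewrite !ge0_integralTE//; apply: ereal_sup_le => _ [h hf <-].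
by exists h => // x; exact: le_trans (hf x) (fg x).
Qed.

(** The sum of simple functions below [f] and [g] is a simple function below
    [f + g].  Additivity may fail without measurability, but this inequality
    is enough to bound a sum of measures of disjoint sets. *)
Lemma integral_superadditive f g : (forall x, 0 <= f x) -> (forall x, 0 <= g x) ->
  \int[mu]_x f x + \int[mu]_x g x <= \int[mu]_x (f x + g x).
Proof.
move=> f0 g0; have fg0 x : 0 <= f x + g x by exact: adde_ge0.
have [->|oo] := eqVneq (\int[mu]_x (f x + g x)) +oo; first by rewrite leey.
have fin : \int[mu]_x (f x + g x) \is a fin_num.
  by rewrite ge0_fin_numE ?lt_neqAle ?oo ?leey// integral_ge0.
have gfin : \int[mu]_x g x \is a fin_num.
  rewrite ge0_fin_numE ?integral_ge0// (@le_lt_trans _ _ (\int[mu]_x (f x + g x)))//.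
    by apply: le_integral_any => // x; exact: leeDr.
  by rewrite lt_neqAle oo leey.
rewrite -leeBrDr// [X in X <= _]ge0_integralTE//.
apply: ge_ereal_sup => _ [h hf <-].
have hfin : sintegral mu h \is a fin_num.
  rewrite ge0_fin_numE ?sintegral_ge0// (@le_lt_trans _ _ (\int[mu]_x (f x + g x)))//.
    rewrite ge0_integralTE//; apply: ereal_sup_ubound; exists h => // x.
    by rewrite (le_trans (hf x))// leeDl.
  by rewrite lt_neqAle oo leey.
rewrite leeBrDr// addeC -leeBrDr// [X in X <= _]ge0_integralTE//.
apply: ge_ereal_sup => _ [k kg <-].
rewrite leeBrDr// addeC -sintegralD [leRHS]ge0_integralTE//.
apply: ereal_sup_ubound; exists (h \+ k)%R => //= x.
by rewrite EFinD leeD.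
Qed.

Lemma integral_sum_superadditive (I : Type) (s : seq I) (F : I -> T -> \bar R) :
  (forall i x, 0 <= F i x) ->
  \sum_(i <- s) \int[mu]_x F i x <= \int[mu]_x \sum_(i <- s) F i x.
Proof.
move=> F0; elim: s => [|i s IH].
  by rewrite big_nil; apply: integral_ge0 => x _; rewrite big_nil.
rewrite big_cons; under [leRHS]eq_integral do rewrite big_cons.
apply: le_trans (integral_superadditive _ _) => //.
  by rewrite leeD2l.
by move=> x; rewrite sume_ge0.
Qed.

End InnerIntegral.

(** * Upper bounds for the iterated Lebesgue measure *)
Section Leb.
Variable R : realType.
Local Open Scope ereal_scope.

Lemma lebS n (A : set (borel 'rV[R]_n.+1)) : leb A =
  \int[lebesgue_measure]_x leb [set y : 'rV[R]_n | A (row_mx (x%:M : 'rV[R]_1) y)].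
Proof. by []. Qed.

Lemma leb_ge0 n (A : set (borel 'rV[R]_n)) : 0 <= leb A.
Proof.
elim: n A => [|n IH] A; first by rewrite /= lee_fin.
by apply: integral_ge0 => x _; exact: IH.
Qed.

Lemma leb_set0 n : leb (set0 : set (borel 'rV[R]_n)) = 0.
Proof.
elim: n => [|n IH] /=; first by rewrite indic0.
by apply: integral0_eq => x _; rewrite -[RHS]IH.
Qed.

(** The total measure of disjoint subsets of a cube is at most that of the
    cube.  By induction on the dimension, slice by slice: superadditivity is
    used in the only valid direction, to move the sum inside the integral. *)
Lemma leb_disjoint_le n (K : R) (I : eqType) (s : seq I) (F : I -> set (borel 'rV[R]_n)) :
  (0 <= K)%R -> uniq s ->
  (forall i j y, i \in s -> j \in s -> F i y -> F j y -> i = j) ->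
  (forall i (y : 'rV[R]_n) k, i \in s -> F i y -> `|y ord0 k| <= K)%R ->
  \sum_(i <- s) leb (F i) <= ((2 * K) ^+ n)%:E.
Proof.
move=> K0; elim: n s F => [|n IH] s F us dF bF.
  rewrite expr0 /=; elim: s us dF {bF} => [|i s IHs] /=.
    by rewrite big_nil lee_fin.
  move=> /andP[iis us] dF; rewrite big_cons.
  have [Fi|Fi] := pselect (F i 0%R); last first.
    rewrite indicE memNset// add0e; apply: IHs => // j k y js ks.
    by apply: dF; rewrite inE ?js ?ks orbT.
  rewrite big_seq big1 ?adde0 ?lee_fin ?indicE ?mem_set// => j js.
  rewrite indicE memNset// => Fj.
  have := dF i j 0%R; rewrite inE eqxx inE js orbT => /(_ isT isT Fi Fj) ij.
  by rewrite ij js in iis.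
under eq_bigr do rewrite lebS.
apply: le_trans (integral_sum_superadditive _ _ _) _ => [i x|]; first exact: leb_ge0.
pose J : set R := `[(- K)%R, K]%classic.
(* The slice at [x] is contained in a cube, and is empty when [x] is not in [J]. *)
apply: (@le_trans _ _ (\int[lebesgue_measure]_x
    (((2 * K) ^+ n)%:E * (\1_J x)%:E))).
  apply: le_integral_any => x; first by rewrite sume_ge0// => i _; exact: leb_ge0.
  have [xK|xK] := pselect (J x).
    rewrite indicE mem_set// mule1; apply: (IH s) => //.
      move=> i j y is_ js; exact: dF.
    move=> i y k is_ /bF - /(_ (rshift 1 k) is_).
    have E := @row_mxEr R 1 1 n (x%:M : 'rV[R]_1) y ord0 k.
    by rewrite -[in X in _ -> X]E.
  rewrite indicE memNset// mule0 big_seq big1// => i is_.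
  rewrite (_ : [set y | _] = set0) ?leb_set0// -subset0 => y /bF - /(_ (@lshift 1 n ord0) is_).
  have E := @row_mxEl R 1 1 n (x%:M : 'rV[R]_1) y ord0 ord0.
  rewrite [X in (`|X| <= _)%R]E mxE eqxx mulr1n => xK'; apply: xK.
  by rewrite /J /= in_itv /= -ler_norml.
have muJ : lebesgue_measure J <= (2 * K)%:E.
  have H := @lebesgue_measure_itv R `[(- K)%R, K]%R.
  rewrite H /=; case: ifP => _; last by rewrite lee_fin mulr_ge0.
  by rewrite -EFinD lee_fin opprK mulr2n mulrDl mul1r.
have mJ : (R.-ocitv.-measurable).-sigma.-measurable J by exact: measurable_itv.
rewrite ge0_integralZl_EFin//; last 2 first.
- by apply/measurable_EFinP; exact: measurable_indic.
- by rewrite exprn_ge0// mulr_ge0.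
rewrite integral_indic// setIT exprSr EFinM lee_pmul//.
by rewrite lee_fin exprn_ge0// mulr_ge0.
Qed.

Import HBNNSimple.

(** An integral against [leb] unfolds to a supremum of sums C * leb (F x) over
    the level sets F x of simple functions; these level sets are disjoint, and
    the previous bound applies to them. *)
Lemma integral_leb_le n (K C : R) (A : set (borel 'rV[R]_n)) (g : borel 'rV[R]_n -> R) :
  (0 <= K)%R -> (0 <= C)%R ->
  (forall (y : 'rV[R]_n) k, A y -> `|y ord0 k| <= K)%R ->
  (forall y, A y -> 0 <= g y <= C)%R ->
  \int[@leb R n]_(y in A) (g y)%:E <= (C * (2 * K) ^+ n)%:E.
Proof.
move=> K0 C0 AK gC.
pose G := (fun y => (g y)%:E) \_ A.
have G0 y : 0 <= G y.
  by rewrite /G patchE; case: ifP => // /[!inE] /gC/andP[g0 _]; rewrite lee_fin.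
have sint0 : sintegral (@leb R n) (cst 0%R) = 0.
  rewrite /sintegral fsbig1// => r _; rewrite preimage_cst.
  by case: ifPn => [/[!inE] <-|]; rewrite ?mul0e// leb_set0 mule0.
rewrite /integral -/G.
(* the integrals of the positive and negative parts *)
set P := ereal_sup _; set N := ereal_sup _.
have N0 : 0 <= N.
  apply: ereal_sup_ubound; exists nnsfun0 => // x.
  by rewrite /= funeneg_ge0.
have PC : P <= (C * (2 * K) ^+ n)%:E.
  apply: ge_ereal_sup => _ [h hG <-].
  have hg x : (h x)%:E <= G x.
    by rewrite (le_trans (hG x))// (@ge0_funeposE _ _ setT) ?inE.
  rewrite /sintegral; set s := finite_support _ _ _.
  (* The level set at 0 is unbounded; its term in the sum is 0, so it is replaced
     by the empty set. *)
  pose F (x : R) : set (borel 'rV[R]_n) := if (0 < x)%R then h @^-1` [set x] else set0.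
  apply: (@le_trans _ _ (\sum_(x <- s) (C%:E * leb (F x)))).
    apply: lee_sum => x _; rewrite /F; case: ifPn => [x0|]; last first.
      rewrite -leNgt le_eqVlt => /predU1P[->|x0]; first by rewrite mul0e leb_set0 mule0.
      rewrite (_ : h @^-1` [set x] = set0) ?leb_set0 ?mule0// -subset0 => y /= hy.
      have : (0 <= h y)%R by [].
      by rewrite hy leNgt x0.
    have [->|/set0P[y /= hy]] := eqVneq (h @^-1` [set x]) set0.
      by rewrite leb_set0 !mule0.
    have xC : (x <= C)%R.
      have := hg y; rewrite /G patchE hy; case: ifP => [/[!inE] Ay|_].
        by rewrite lee_fin => xg; apply: (le_trans xg); have /andP[] := gC _ Ay.
      by rewrite lee_fin leNgt x0.
    by rewrite lee_pmul ?leb_ge0// lee_fin// ltW.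
  rewrite -ge0_sume_distrr; last by move=> x _; exact: leb_ge0.
  rewrite EFinM lee_pmul ?lee_fin ?sume_ge0// => [x _|]; first exact: leb_ge0.
  apply: leb_disjoint_le => //.
  - exact: finite_support_uniq.
  - by move=> x x' y _ _; rewrite /F; case: ifP => // _ /= <-; case: ifP => // _ /= <-.
  - move=> x y k _; rewrite /F; case: ifP => // x0 /= hy.
    have := hg y; rewrite /G patchE; case: ifP => [/[!inE] Ay|_]; first by move=> _; exact: AK.
    by rewrite lee_fin hy leNgt x0.
rewrite -[leRHS]sube0; apply: leeB => //.
Qed.

End Leb.

(** * Finiteness of the volume of small balls *)
Section SmallBalls.
Variables (R : realType) (n : nat) (M : riemannianManifold R n).
Implicit Types (p q x : M).
Variable mu : {measure set (borel M) -> \bar R}.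
Hypothesis vol : is_riemannian_volume mu.

Lemma det_le (A : 'M[R]_n) (B : R) : (forall i j, `|A i j| <= B) ->
  \det A <= (n`!)%:R * B ^+ n.
Proof.
move=> AB; apply: (le_trans (ler_norm _)); apply: (le_trans (ler_norm_sum _ _ _)).
have -> : (n`!)%:R * B ^+ n = \sum_(s : 'S_n) B ^+ n.
  by rewrite sumr_const card_Sn mulr_natl.
apply: ler_sum => s _; rewrite normrM normrX normrN1 expr1n mul1r normr_prod.
have -> : B ^+ n = \prod_(i < n) B by rewrite prodr_const card_ord.
by apply: ler_prod => i _; rewrite normr_ge0 /=; exact: AB.
Qed.

Lemma measurable_gball p r : measurable (geodesic_ball p r : set (borel M)).
Proof. by apply: sub_sigma_algebra; exact: open_gball. Qed.

(** Near [p] the coordinates and the density sqrt(det g) are bounded. *)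
Lemma vol_small_ball p : exists2 r : R, 0 < r & (mu (geodesic_ball p r) < +oo)%E.
Proof.
set a := chart_at p; set o := chart a p.
have ap : chart_dom a p by exact: mem_chart_at.
have ao : chart_cod a o by exact: chart_cod_chart.
have cg : {for o, continuous (metric a)}.
  exact: (smooth_on_continuous (@metric_smooth _ _ M a) ao).
pose B := `|metric a o| + 1.
have H : \forall z \near o, `|metric a o - metric a z| < 1 /\ `|o - z| < 1.
  apply: filterI; first by move/cvgr_dist_lt : cg; apply.
  have := @cvg_id _ (nbhs o); move/cvgr_dist_lt; apply; exact: ltr01.
have V : nbhs p (fun x => chart_dom a x /\
    (`|metric a o - metric a (chart a x)| < 1 /\ `|o - chart a x| < 1)).
  apply: filterI; first exact: open_near (@chart_dom_open _ _ M a) ap _.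
  exact: (@chart_continuous _ _ M _ _ ap _ H).
have [r r0 rV] := nbhs_gball V.
exists r => //.
rewrite (vol (i := a) (measurable_gball p r)); last by move=> x /rV[].
apply: le_lt_trans (ltry (Num.sqrt ((n`!)%:R * B ^+ n) * (2 * (`|o| + 1)) ^+ n)).
have near1 (m k : nat) (u v : 'M[R]_(m, k)) i j : `|u - v| < 1 -> `|v i j| <= `|u| + 1.
  move=> uv; apply: (le_trans (le_entry_norm _ _ _)).
  rewrite -[v](subrK u) addrC (le_trans (ler_normD _ _))// lerD2l.
  by rewrite distrC ltW.
apply: integral_leb_le.
- by rewrite addr_ge0.
- exact: sqrtr_ge0.
- by move=> y k [x /rV[_ [_ ox]] <-]; exact: near1.
- move=> y [x /rV[_ [gx _]] <-]; rewrite sqrtr_ge0 /= ler_wsqrtr// det_le// => i j.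
  exact: near1.
Qed.

End SmallBalls.

(** * Consequences of doubling: finite volume, total boundedness, compactness *)
Section Doubling.
Variables (R : realType) (n : nat) (M : riemannianManifold R n).
Implicit Types (p q x : M).
Variable mu : {measure set (borel M) -> \bar R}.
Hypothesis vol : is_riemannian_volume mu.
Variable D : R.
Hypothesis doubling : doubling_constant mu D.

Let D0 : 0 < D. Proof. by case: doubling. Qed.

Lemma doubling_iter k p r : 0 < r ->
  (mu (geodesic_ball p (2 ^+ k * r)) <= (D ^+ k)%:E * mu (geodesic_ball p r))%E.
Proof.
move=> r0; elim: k => [|k IH]; first by rewrite !expr0 mul1r mul1e.
have [_ /(_ (2 ^+ k * r) p)] := doubling.
rewrite mulr_gt0 ?exprn_gt0// => /(_ isT).
rewrite exprS -mulrA => /le_trans; apply.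
by rewrite exprS EFinM -muleA lee_pmul2l ?lte_fin.
Qed.

Lemma le_natr (r : R) : exists k : nat, r <= k%:R.
Proof. by exists (Num.truncn `|r|).+1; rewrite (le_trans (ler_norm _))// ltW// truncnS_gt. Qed.

Lemma le_pow2 (r s : R) : 0 < s -> exists k, r <= 2 ^+ k * s.
Proof.
move=> s0; have [k rk] := le_natr (r / s).
exists k; rewrite -ler_pdivrMr// (le_trans rk)// -natrX ler_nat.
by apply: ltnW; exact: ltn_expl.
Qed.

Lemma le_vol_gball p q r s : geodesic_ball p r `<=` geodesic_ball q s ->
  (mu (geodesic_ball p r) <= mu (geodesic_ball q s))%E.
Proof. by move=> H; apply: le_measure => //; rewrite inE; exact: measurable_gball. Qed.

(** Doubling bounds the volume of a large ball by that of a small one. *)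
Lemma vol_ball_finite p r : (mu (geodesic_ball p r) < +oo)%E.
Proof.
have [s s0 sfin] := vol_small_ball vol p.
have [k rk] := le_pow2 r s0.
apply: (le_lt_trans (le_vol_gball (gball_le rk))).
apply: (le_lt_trans (doubling_iter k p s0)).
have : mu (geodesic_ball p s) \is a fin_num by rewrite ge0_fin_numE.
by move=> /fineK <-; rewrite -EFinM ltry.
Qed.

Lemma vol_disjoint_balls (s : seq M) (U : set M) e :
  (forall q, q \in s -> geodesic_ball q e `<=` U) ->
  pairwise (fun p q => `[< geodesic_ball p e `&` geodesic_ball q e = set0 >]) s ->
  (\sum_(q <- s) mu (geodesic_ball q e) =
    mu (\big[setU/set0]_(q <- s) geodesic_ball q e))%E /\
  \big[setU/set0]_(q <- s) geodesic_ball q e `<=` U.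
Proof.
elim: s => [|p s IH] sU; first by move=> _; rewrite !big_nil measure0; split=> [//|x []].
rewrite /= => /andP[ps dj]; rewrite !big_cons.
have [|-> US] := IH _ dj; first by move=> q qs; apply: sU; rewrite inE qs orbT.
have pU : geodesic_ball p e `<=` U by apply: sU; rewrite inE eqxx.
split; last by rewrite subUset.
rewrite measureU//; [exact: measurable_gball|by apply: bigsetU_measurable => q _; exact: measurable_gball|].
rewrite big_distrr /= big_seq big1// => q qs.
by move/allP : ps => /(_ q qs)/asboolP.
Qed.

Variable x0 : M.
Hypothesis x0_pos : forall r, 0 < r -> (0 < mu (geodesic_ball x0 r))%E.

(** The balls of radius e/2 around the points of an e-separated set are
    disjoint and contained in B(x0, r + e).  Each of them has volume at least
    V(r) / D^k: multiplied by 2^k it contains B(x0, r). *)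
Lemma packing_bound r e : 0 < r -> 0 < e -> exists N : nat, forall s : seq M,
  (forall q, q \in s -> geodesic_ball x0 r q) ->
  pairwise (fun p q => `[< ~ geodesic_ball p e q >]) s -> (size s <= N)%N.
Proof.
move=> r0 e0; have e20 : 0 < e / 2 by rewrite divr_gt0.
have [k rk] := le_pow2 (2 * r) e20.
have fin p t : mu (geodesic_ball p t) \is a fin_num.
  by rewrite ge0_fin_numE// vol_ball_finite.
pose v := fine (mu (geodesic_ball x0 r)).
pose V := fine (mu (geodesic_ball x0 (r + e))).
have v0 : 0 < v by rewrite fine_gt0// x0_pos// -ge0_fin_numE ?fin.
have [N HN] := le_natr (D ^+ k * V / v).
exists N => s sB sS.
have sU q : q \in s -> geodesic_ball q (e / 2) `<=` geodesic_ball x0 (r + e).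
  move=> /sB xq y qy; apply: gball_le (gball_trans xq qy).
  by rewrite lerD2l ler_pdivrMr// ler_peMr ?ler1n// ltW.
have dj : pairwise (fun p q => `[< geodesic_ball p (e / 2) `&` geodesic_ball q (e / 2) = set0 >]) s.
  apply: sub_pairwise sS => p q /asboolP pq; apply/asboolP.
  rewrite -subset0 => y [py qy]; apply: pq.
  by rewrite [e]splitr; exact: gball_trans py (gball_sym qy).
have [E US] := vol_disjoint_balls sU dj.
have lower q : q \in s -> ((v / D ^+ k)%:E <= mu (geodesic_ball q (e / 2)))%E.
  move=> qs; have := doubling_iter k q e20.
  have : (mu (geodesic_ball x0 r) <= mu (geodesic_ball q (2 ^+ k * (e / 2))))%E.
    apply: le_vol_gball => y xy; apply: gball_le rk _ _.
    by rewrite mulr2n mulrDl mul1r; exact: gball_trans (gball_sym (sB _ qs)) xy.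
  move=> /le_trans H /H {H}.
  rewrite -(fineK (fin x0 r)) -(fineK (fin q (e / 2))) -EFinM !lee_fin -/v.
  by rewrite mulrC -ler_pdivrMr// exprn_gt0.
have : (\sum_(q <- s) (v / D ^+ k)%:E <= V%:E)%E.
  rewrite /V fineK//; apply: (@le_trans _ _ (\sum_(q <- s) mu (geodesic_ball q (e / 2)))%E).
    by rewrite big_seq [leRHS]big_seq; apply: lee_sum => q; exact: lower.
  rewrite E; apply: le_measure => //; rewrite inE; last exact: measurable_gball.
  by apply: bigsetU_measurable => q _; exact: measurable_gball.
rewrite sumEFin lee_fin big_const_seq count_predT iter_addr addr0 => H.
rewrite -(@ler_nat R) (le_trans _ HN)// ler_pdivlMr// -ler_pdivrMl ?exprn_gt0//.
by rewrite mulrCA [_^-1 * v]mulrC mulr_natl.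
Qed.

(** Otherwise one could add points forever to a separated family. *)
Lemma gball_totally_bounded r e : 0 < r -> 0 < e -> exists s : seq M,
  (forall q, q \in s -> geodesic_ball x0 r q) /\
  forall x, geodesic_ball x0 r x -> exists2 q, q \in s & geodesic_ball q e x.
Proof.
move=> r0 e0; have [N HN] := packing_bound r0 e0.
apply: contrapT => nocover.
have [s [sB sS sN]] : exists s : seq M, [/\ forall q, q \in s -> geodesic_ball x0 r q,
    pairwise (fun p q => `[< ~ geodesic_ball p e q >]) s & size s = N.+1].
  elim: N.+1 => [|m [s [sB sS sm]]]; first by exists [::].
  have [x [xB xs]] : exists x, geodesic_ball x0 r x /\
      forall q, q \in s -> ~ geodesic_ball x e q.
    apply: contrapT => nx; apply: nocover; exists s; split=> // x xB.
    apply: contrapT => nq; apply: nx; exists x; split=> // q qs xq.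
    by apply: nq; exists q => //; exact: gball_sym.
  exists (x :: s); split=> [q||]; last by rewrite /= sm.
    by rewrite inE => /predU1P[->|/sB].
  by rewrite /= sS andbT; apply/allP => q /xs ?; apply/asboolP.
by have := HN s sB sS; rewrite sN ltnn.
Qed.

Lemma ultra_seq (F : set_system M) (FU : UltraFilter F) (s : seq M) (A : M -> set M) :
  F [set x | exists2 q, q \in s & A q x] -> exists2 q, q \in s & F (A q).
Proof.
elim: s => [|p s IH] Fs.
  have : F set0 by apply: filterS Fs => x [].
  by move=> /filter_not_empty.
have [Fp|Fp] := in_ultra_setVsetC (A p) FU; first by exists p => //; rewrite inE eqxx.
have [|q qs Fq] := IH; last by exists q => //; rewrite inE qs orbT.
apply: filterS (filterI Fs Fp) => x [[q]]; rewrite inE => /predU1P[->//|qs] qx _.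
by exists q.
Qed.

(** An ultrafilter on a totally bounded set contains balls of arbitrarily small
    radius; their centres form a Cauchy sequence, and its limit is the limit of
    the ultrafilter. *)
Lemma compact_closure_bounded (S : set M) r : complete_manifold M -> 0 < r ->
  S `<=` geodesic_ball x0 r -> compact (closure S).
Proof.
move=> complM r0 Sr; rewrite compact_ultra => F FU FS.
have FB : F (geodesic_ball x0 (r + 1)).
  by apply: filterS FS; exact: closure_gball ltr01 Sr.
have r10 : 0 < r + 1 by rewrite addr_gt0.
have : forall k : nat, exists q, F (geodesic_ball q k.+1%:R^-1).
  move=> k; have k0 : 0 < k.+1%:R^-1 :> R by rewrite invr_gt0.
  have [s [_ scov]] := gball_totally_bounded r10 k0.
  have [|q _ Fq] := @ultra_seq F FU s (fun q => geodesic_ball q k.+1%:R^-1); last by exists q.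
  by apply: filterS FB => x /scov.
move=> /choice[s Fs].
have small (e : R) : 0 < e -> exists N : nat, forall k, (N <= k)%N -> k.+1%:R^-1 < e.
  move=> e0; have [N HN] := le_natr e^-1.
  exists N => k Nk; rewrite -[e]invrK ltf_pV2 ?posrE ?invr_gt0//.
  by rewrite (le_lt_trans HN)// ltr_nat.
have [|x sx] := complM s.
  move=> e e0; have e20 : 0 < e / 2 by rewrite divr_gt0.
  have [N HN] := small _ e20; exists N => k l Nk Nl.
  have [y [ky ly]] := filter_ex (filterI (Fs k) (Fs l)).
  suff : geodesic_ball (s k) e (s l) by [].
  rewrite [e]splitr; apply: gball_trans (gball_le (ltW (HN k Nk)) ky) _.
  exact: gball_sym (gball_le (ltW (HN l Nl)) ly).
have Fx : F --> x.
  move=> V /nbhs_gball[e e0 eV].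
  have e20 : 0 < e / 2 by rewrite divr_gt0.
  have [N HN] := small _ e20.
  have [k [Nk kx]] : exists k, (N <= k)%N /\ geodesic_ball (s k) (e / 2) x.
    have e2E : ((0 : \bar R) < (e / 2)%:E)%E by rewrite lte_fin.
    have [k [? ?]] := filter_ex (@filterI _ _ _ _ _ (nbhs_infty_ge N)
      (sx _ (open_ereal_lt_ereal e2E))).
    by exists k.
  apply: filterS (Fs k) => y ky; apply: eV; rewrite [e]splitr.
  exact: gball_trans (gball_sym kx) (gball_le (ltW (HN k Nk)) ky).
exists x; split=> //; apply: closed_closure => V xV.
exact: filter_ex (filterI FS (Fx _ xV)).
Qed.

End Doubling.

(** * The soft maximum of finitely many functions *)
Section SoftMax.
Variables (R : realType) (V : normedModType R) (I : Type).
Implicit Types (s : seq I) (b : I -> V -> R) (l : R).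

(** The sum is normalised by the number of functions, so that the soft maximum
    is 0 wherever all the functions vanish. *)
Definition softmax l s b (z : V) : R :=
  l^-1 * ln ((size s)%:R^-1 * \sum_(i <- s) expR (l * b i z)).

Lemma softmax_arg_gt0 l s b z : (0 < size s)%N ->
  0 < (size s)%:R^-1 * \sum_(i <- s) expR (l * b i z).
Proof.
case: s => // i s _; rewrite mulr_gt0 ?invr_gt0 ?ltr0n// big_cons.
by rewrite ltr_pwDl ?expR_gt0// sumr_ge0// => j _; exact: expR_ge0.
Qed.

Lemma softmax_eq0 l s b z : (0 < size s)%N -> (forall i, b i z = 0) ->
  softmax l s b z = 0.
Proof.
move=> s0 b0; rewrite /softmax (eq_bigr (fun=> 1)); last first.
  by move=> i _; rewrite b0 mulr0 expR0.
rewrite big_const_seq count_predT iter_addr addr0 -[1 *+ _]/((size s)%:R).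
by rewrite mulVf ?ln1 ?mulr0// pnatr_eq0 -lt0n.
Qed.

Lemma is_derive_sum_seq s (f : I -> V -> R) (df : I -> R) z v :
  (forall i, is_derive z v (f i) (df i)) ->
  is_derive z v (fun z => \sum_(i <- s) f i z : R) (\sum_(i <- s) df i).
Proof.
move=> H; elim: s => [|i s IH].
  rewrite big_nil (_ : (fun _ => _) = cst 0); first exact: is_derive_cst.
  by apply/funext => w; rewrite big_nil.
rewrite big_cons (_ : (fun _ => _) = f i + (fun z => \sum_(i <- s) f i z : R)).
  exact: is_deriveD.
by apply/funext => w; rewrite big_cons.
Qed.

(** The derivative is the average of the derivatives of the b_i with weights
    proportional to exp (l b_i).  The bound does not depend on the number of
    functions, contrary to that for a sum. *)
Lemma softmax_derive l s b z v (db : I -> R) (L : R) : 0 < l -> (0 < size s)%N ->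
  (forall i, is_derive z v (b i) (db i)) -> (forall i, `|db i| <= L) ->
  exists2 a : R, is_derive z v (softmax l s b) a & `|a| <= L.
Proof.
move=> l0 s0 Db bL.
have dE i : is_derive z v (fun z => expR (l * b i z)) (expR (l * b i z) * (l * db i)).
  exact: (is_derive_comp1 (is_deriveZ l (Db i)) (is_derive_expR _)).
have dS := is_derive_sum_seq s dE.
have dA := is_deriveZ (size s)%:R^-1 dS.
have dL := is_derive_comp1 dA (is_derive1_ln (softmax_arg_gt0 l b z s0)).
have dM := is_deriveZ l^-1 dL.
exists ((\sum_(i <- s) expR (l * b i z))^-1 * \sum_(i <- s) (expR (l * b i z) * db i)).
  apply: (is_derive_eq dM).
  have -> : \sum_(i <- s) expR (l * b i z) * (l * db i) =
      l * \sum_(i <- s) expR (l * b i z) * db i.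
    by rewrite mulr_sumr; apply: eq_bigr => i _; rewrite mulrCA.
  rewrite /GRing.scale /= invfM invrK.
  set S := (\sum_(i <- s) expR (l * b i z))^-1; set Q := \sum_(i <- s) _.
  have ss : (size s)%:R != 0 :> R by rewrite pnatr_eq0 -lt0n.
  have l0' : l != 0 by rewrite gt_eqF.
  by field; rewrite ss l0'.
have S0 : 0 < \sum_(i <- s) expR (l * b i z).
  by have := softmax_arg_gt0 l b z s0; rewrite pmulr_rgt0// invr_gt0 ltr0n.
rewrite normrM normfV (gtr0_norm S0) ler_pdivrMl//.
apply: le_trans (ler_norm_sum _ _ _) _.
rewrite mulr_suml; apply: ler_sum => i _.
by rewrite normrM (gtr0_norm (expR_gt0 _)) ler_wpM2l// expR_ge0.
Qed.

(** With N functions, normalisation costs (log N) / l, which is at most 1/4 for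
    l = 4 N.  The hypothesis on [t] holds when [t] is one of the values b_i z. *)
Lemma softmax_ge l s b z : l = 4 * (size s)%:R -> (0 < size s)%N ->
  (exists2 t, 2^-1 <= t & expR (l * t) <= \sum_(i <- s) expR (l * b i z)) ->
  4^-1 <= softmax l s b z.
Proof.
move=> lE s0 [t t2 tS].
have l0 : 0 < l by rewrite lE mulr_gt0// ltr0n.
rewrite /softmax ler_pdivlMl// -[leLHS]expRK ler_ln ?posrE ?expR_gt0 ?softmax_arg_gt0//.
rewrite ler_pdivlMl ?ltr0n//.
apply: le_trans tS.
(* Half of the exponent pays for the factor N <= exp N = exp (l / 4). *)
apply: (@le_trans _ _ (expR (l * 4^-1) * expR (l * 4^-1))).
  rewrite ler_wpM2r ?expR_ge0// lE mulrC mulKf// (le_trans _ (expR_ge1Dx _))//.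
  by rewrite lerDr.
rewrite -expRD ler_expR -mulrDr ler_pM2l// (le_trans _ t2)//; lra.
Qed.

End SoftMax.

(** * Cutoff functions for balls, by levels *)
Section Cutoff.
Variables (R : realType) (n : nat) (M : riemannianManifold R n).
Implicit Types (p q x y : M) (i : chart_index M) (v : 'rV[R]_n) (u w : M -> R).

Lemma smooth_fun_is_derive u i z v : smooth_fun u -> chart_cod i z ->
  is_derive z v (u \o chart_inv i : 'rV[R]_n -> R^o)
    ('D_v (u \o chart_inv i : 'rV[R]_n -> R^o) z).
Proof. by move=> su iz; apply: derivableP; exact: smooth_on_derivable (su i) iz. Qed.

Lemma deriv_leI u x (L : R) :
  (forall i v, chart_dom i x -> exists2 a : R,
    is_derive (chart i x) v (u \o chart_inv i : 'rV[R]_n -> R^o) a &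
    `|a| <= L * chart_norm i (chart i x) v) -> deriv_le u x L.
Proof. by move=> H i v ix; have [a [_ ->]] := H i v ix. Qed.

Lemma smooth_fun_cst (a : R) : smooth_fun (cst a : M -> R).
Proof. by move=> i; apply: smooth_on_cst; exact: chart_cod_open. Qed.

Lemma smooth_funD u w : smooth_fun u -> smooth_fun w -> smooth_fun (fun x => u x + w x).
Proof. by move=> su sw i; apply: (smooth_onD (@chart_cod_open _ _ M i) (su i) (sw i)). Qed.

Lemma deriv_le_cst (a L : R) x : 0 <= L -> deriv_le (cst a : M -> R) x L.
Proof.
move=> L0 i v ix; rewrite (_ : _ \o _ = cst a) // derive_cst normr0 mulr_ge0//.
exact: sqrtr_ge0.
Qed.

Lemma deriv_leD u w x (K L : R) : smooth_fun u -> smooth_fun w ->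
  deriv_le u x K -> deriv_le w x L -> deriv_le (fun x => u x + w x) x (K + L).
Proof.
move=> su sw uK wL; apply: deriv_leI => i v ix.
have iz := chart_cod_chart ix.
eexists; first exact: is_deriveD (smooth_fun_is_derive v su iz) (smooth_fun_is_derive v sw iz).
by rewrite (le_trans (ler_normD _ _))// mulrDl lerD//; [exact: uK|exact: wL].
Qed.

Lemma deriv_leZ u x (a L : R) : smooth_fun u -> 0 <= a ->
  deriv_le u x L -> deriv_le (fun x => a * u x) x (a * L).
Proof.
move=> su a0 uL; apply: deriv_leI => i v ix.
have iz := chart_cod_chart ix.
exists (a * 'D_v (u \o chart_inv i : 'rV[R]_n -> R^o) (chart i x)).
  exact: (is_deriveZ a (smooth_fun_is_derive v su iz)).
by rewrite normrM ger0_norm// -mulrA ler_wpM2l//; exact: uL.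
Qed.

Lemma smooth_funZ u (a : R) : smooth_fun u -> smooth_fun (fun x => a * u x).
Proof.
move=> su i; have oi := @chart_cod_open _ _ M i.
exact: (smooth_onM oi (smooth_on_cst a oi) (su i)).
Qed.

(** Fermat's theorem along each line through the point in a chart. *)
Lemma deriv_le_extremum u x : smooth_fun u ->
  (forall y, u x <= u y) \/ (forall y, u y <= u x) -> deriv_le u x 0.
Proof.
move=> su ex i v ix; have iz := chart_cod_chart ix.
rewrite mul0r normr_le0.
pose U := u \o chart_inv i : 'rV[R]_n -> R^o.
pose F (t : R) : R := U (t *: v + chart i x).
have F0 : F 0 = u x by rewrite /F /U /= scale0r add0r chartK.
have : \forall t \near (0 : R), chart_cod i (t *: v + chart i x).
  have ct : {for (0 : R), continuous (fun t : R => t *: v + chart i x)}.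
    apply: differentiable_continuous; apply/derivable1_diffP.
    by have [] := is_derive_line (@derivable_id R 'rV[R]_n (0 *: v + chart i x) v).
  apply: ct; rewrite scale0r add0r.
  exact: open_nbhs_nbhs (conj (@chart_cod_open _ _ M i) iz).
move=> /nbhs_ballP[e /= e0 He].
have dF (t : R) : t \in `]- e, e[%R -> is_derive t 1 F ('D_v U (t *: v + chart i x)).
  rewrite in_itv /= => te; apply: is_derive_line.
  apply: smooth_on_derivable (su i) _; apply: He.
  by rewrite -ball_normE /ball_ /= sub0r normrN ltr_norml.
have dF' (t : R) : t \in `]- e, e[%R -> derivable F t 1 by move=> /dF[].
have e00 : 0 \in `]- e, e[%R by rewrite in_itv /= oppr_lt0 e0.
have ee : - e <= e by rewrite (le_trans _ (ltW e0))// oppr_le0 ltW.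
have F' : is_derive (0 : R) 1 F 0.
  case: ex => H.
    by apply: derive1_at_min ee dF' e00 _ => t _; rewrite F0; exact: H.
  by apply: derive1_at_max ee dF' e00 _ => t _; rewrite F0; exact: H.
have [_ E1] := dF 0 e00; have [_ E2] := F'.
by move: E1; rewrite E2 scale0r add0r => <-.
Qed.

(** A smooth substitute for the indicator function of the union of the supports
    of the b_q, with a gradient no larger than theirs up to a constant.  The
    step turns values of the soft maximum above 1/4 into 1. *)
Lemma soft_union (s : seq M) (b : M -> M -> R) (L : R) : (0 < size s)%N ->
  (forall q, smooth_fun (b q)) -> (forall q x, deriv_le (b q) x L) ->
  exists w, [/\ smooth_fun w, forall x, 0 <= w x <= 1,
    forall x, deriv_le w x (smooth_step_lip R * L),
    forall x, (forall q, b q x = 0) -> w x = 0 &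
    forall x, (exists2 q, q \in s & 2^-1 <= b q x) -> w x = 1].
Proof.
move=> s0 sb bL; pose l : R := 4 * (size s)%:R.
have l0 : 0 < l by rewrite mulr_gt0// ltr0n.
(* The soft maximum only depends on the values b_q x; they are regarded as
   constant functions on the line, as [M] is not a normed space. *)
exists (fun x => smooth_step (softmax (V := R) l s (fun q _ => b q x) 0)); split.
- move=> i; have oi := @chart_cod_open _ _ M i.
  have Hm (a : R) (f : 'rV[R]_n -> R^o) : smooth_on (chart_cod i) f ->
    smooth_on (chart_cod i) (fun z => a * f z : R^o).
    by move=> sf; exact: (smooth_onM oi (smooth_on_cst a oi) sf).
  have He q := smooth_on_expR oi (Hm l _ (sb q i)).
  have Hs := smooth_on_sum s oi He.
  have Hl := smooth_on_ln oi _ (Hm (size s)%:R^-1 _ Hs).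
  apply: (smooth_on_step oi (Hm l^-1 _ (Hl _))) => z iz.
  exact: (softmax_arg_gt0 (V := R) l (fun q _ => b q (chart_inv i z)) 0 s0).
- by move=> x; exact: smooth_step01.
- move=> x; apply: deriv_leI => i v ix; have iz := chart_cod_chart ix.
  have [q|q|a Da aL] := softmax_derive l0 s0 (b := fun q => b q \o chart_inv i : 'rV[R]_n -> R^o)
    (z := chart i x) (v := v) (db := fun q => 'D_v (b q \o chart_inv i : 'rV[R]_n -> R^o) (chart i x))
    (L := L * chart_norm i (chart i x) v).
  + exact: smooth_fun_is_derive.
  + exact: bL.
  have [c Dc cL] := smooth_step_derive (softmax l s (fun q => b q \o chart_inv i : 'rV[R]_n -> R^o) (chart i x)).
  exists (c * a); first exact: (is_derive_comp1 Da Dc).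
  by rewrite normrM -mulrA ler_pM.
- by move=> x b0; rewrite softmax_eq0//; exact: smooth_step_le0.
- move=> x [q qs b2]; apply: smooth_step_ge; apply: softmax_ge => //.
  exists (b q x) => //.
  rewrite (big_rem q)//= lerDl sumr_ge0// => y _; exact: expR_ge0.
Qed.

Variable x0 : M.
Variables (d : R).
Hypothesis d0 : 0 < d.

(** Each bump stays above 1/2 on the ball of radius d / (2 [bump_lip]) around
    its centre, so a net of that mesh makes every point of B(x0, a) close
    enough to one of the centres. *)
Lemma level_cutoff (a : R) :
  0 < a ->
  (forall q, geodesic_ball x0 a q -> exists b, bump_at q d b) ->
  (exists s : seq M, (forall q, q \in s -> geodesic_ball x0 a q) /\
    forall x, geodesic_ball x0 a x -> exists2 q, q \in s & geodesic_ball q (d / (2 * bump_lip R)) x) ->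
  exists w, [/\ smooth_fun w, forall x, 0 <= w x <= 1,
    forall x, deriv_le w x (smooth_step_lip R * (bump_lip R / d)),
    forall x, geodesic_ball x0 a x -> w x = 1 &
    forall x, ~ geodesic_ball x0 (a + d) x -> w x = 0].
Proof.
move=> a0 Hb [s [sB scov]].
have L0 : 0 < bump_lip R / d by rewrite divr_gt0 ?bump_lip_gt0.
have : forall q, exists b, [/\ smooth_fun b, forall x, deriv_le b x (bump_lip R / d),
    forall x, ~ geodesic_ball x0 (a + d) x -> b x = 0 &
    geodesic_ball x0 a q -> forall x, geodesic_ball q (d / (2 * bump_lip R)) x -> 2^-1 <= b x].
  move=> q; have [qa|qa] := pselect (geodesic_ball x0 a q); last first.
    exists (cst 0); split=> //; first exact: smooth_fun_cst.
    by move=> x; apply: deriv_le_cst; exact: ltW.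
  have [b [sb b01 b1 bL bB]] := Hb q qa.
  exists b; split=> //.
    move=> x xa; apply/eqP; apply: contraT => /bB qx; case: xa.
    exact: gball_trans qa qx.
  move=> _ x qx; have := gball_lipschitz sb L0 bL qx.
  rewrite b1 distrC => /ltW/(le_trans (ler_norm _)).
  have -> : bump_lip R / d * (d / (2 * bump_lip R)) = 2^-1.
    by field; rewrite !gt_eqF ?bump_lip_gt0.
  by move=> H; lra.
move=> /choice[b Hbb].
have s0 : (0 < size s)%N.
  by have [q] := scov x0 (gball_center x0 a0); case: (s).
have [||w [sw w01 wL w0 w1]] := @soft_union s b (bump_lip R / d) s0.
- by move=> q; have [] := Hbb q.
- by move=> q; have [] := Hbb q.
exists w; split=> //.
- move=> x /scov[q qs qx]; apply: w1; exists q => //.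
  by have [_ _ _] := Hbb q; apply; [exact: sB|].
- by move=> x xa; apply: w0 => q; have [_ _ H _] := Hbb q; exact: H.
Qed.

(** The levels rise one after the other, on disjoint annuli of width [d]: where
    one of them is not at an extremum, all the others are, and their
    differentials vanish.  So the sum of the [K] levels is no steeper than a
    single one. *)
Lemma staircase (a : R) K : 0 < a ->
  (forall q, geodesic_ball x0 (a + K%:R * d) q -> exists b, bump_at q d b) ->
  (forall r, 0 < r -> exists s : seq M, (forall q, q \in s -> geodesic_ball x0 r q) /\
    forall x, geodesic_ball x0 r x -> exists2 q, q \in s & geodesic_ball q (d / (2 * bump_lip R)) x) ->
  exists u, [/\ smooth_fun u, forall x, 0 <= u x <= K%:R,
    forall x, deriv_le u x (smooth_step_lip R * (bump_lip R / d)),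
    forall x, geodesic_ball x0 a x -> u x = K%:R &
    forall x, ~ geodesic_ball x0 (a + K%:R * d) x -> u x = 0].
Proof.
move=> a0 Hb cov; elim: K Hb => [|K IH] Hb.
  exists (cst 0); split=> //; first exact: smooth_fun_cst.
    by move=> x; rewrite lexx.
  move=> x; apply: deriv_le_cst; rewrite !mulr_ge0 ?expR_ge0 ?invr_ge0//; exact: ltW.
have KS : a + K.+1%:R * d = a + K%:R * d + d by rewrite mulrS mulrDl mul1r (addrC d) addrA.
have aK0 : 0 < a + K%:R * d by rewrite ltr_pwDl// mulr_ge0// ltW.
have Hb' q : geodesic_ball x0 (a + K%:R * d) q -> exists b, bump_at q d b.
  by move=> qa; apply: Hb; apply: gball_le qa; rewrite KS lerDl ltW.
have [u [su u0K uL u1 u0]] := IH Hb'.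
have [w [sw w01 wL w1 w0]] := level_cutoff aK0 Hb' (cov _ aK0).
exists (fun x => u x + w x); split.
- exact: smooth_funD.
- move=> x; have /andP[? ?] := u0K x; have /andP[? ?] := w01 x.
  by rewrite addr_ge0//= -natr1 lerD.
(* Inside the ball the new level is maximal, outside it the old sum is minimal. *)
- move=> x; have [xa|xa] := pselect (geodesic_ball x0 (a + K%:R * d) x).
    rewrite -[_ * _]addr0; apply: deriv_leD => //; apply: deriv_le_extremum => //; right.
    by move=> y; rewrite (w1 x)//; have /andP[] := w01 y.
  rewrite -[_ * _]add0r; apply: deriv_leD => //; apply: deriv_le_extremum => //; left.
  by move=> y; rewrite (u0 x)//; have /andP[] := u0K y.
- move=> x xa; rewrite u1// w1 ?natr1//.
  by apply: gball_le xa; rewrite lerDl mulr_ge0// ltW.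
- move=> x xa; rewrite w0 -?KS// u0 ?addr0// => xa'; apply: xa.
  by apply: gball_le xa'; rewrite KS lerDl ltW.
Qed.

End Cutoff.

(** * Real integrals of functions that may fail to be measurable *)
Section RealIntegral.
Context d (T : measurableType d) (R : realType).
Variable mu : {measure set T -> \bar R}.

(** Both the positive and the negative part of [f] are below [h], and the
    difference of two numbers between 0 and A is between -A and A. *)
Lemma Rintegral_abs_le (f : T -> R) (h : T -> \bar R) :
  (forall x, (`|f x|%:E <= h x)%E) -> (\int[mu]_x h x < +oo)%E ->
  `|(\int[mu]_x f x)%R| <= fine (\int[mu]_x h x)%E.
Proof.
move=> fh hfin.
have h0 x : (0 <= h x)%E by apply: le_trans (fh x); rewrite lee_fin.
have I0 : (0 <= \int[mu]_x h x)%E by exact: integral_ge0.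
have pos : (\int[mu]_x (EFin \o f)^\+ x <= \int[mu]_x h x)%E.
  apply: le_integral_any => x; first exact: funepos_ge0.
  apply: le_trans (fh x); rewrite funeposE /= -EFin_max lee_fin.
  by rewrite ge_max ler_norm normr_ge0.
have neg : (\int[mu]_x (EFin \o f)^\- x <= \int[mu]_x h x)%E.
  apply: le_integral_any => x; first exact: funeneg_ge0.
  apply: le_trans (fh x); rewrite funenegE /= -EFin_max lee_fin.
  by rewrite ge_max -normrN ler_norm normr_ge0.
have pos0 : (0 <= \int[mu]_x (EFin \o f)^\+ x)%E by apply: integral_ge0 => x _; exact: funepos_ge0.
have neg0 : (0 <= \int[mu]_x (EFin \o f)^\- x)%E by apply: integral_ge0 => x _; exact: funeneg_ge0.
rewrite /Rintegral integralE.
move: pos neg pos0 neg0 I0 hfin.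
case: (\int[mu]_x h x)%E => [c| |]//; case: (\int[mu]_x (EFin \o f)^\+ x)%E => [a| |]//.
case: (\int[mu]_x (EFin \o f)^\- x)%E => [b| |]//=.
rewrite !lee_fin => ac bc a0 b0 _ _.
by rewrite ler_norml; apply/andP; split; lra.
Qed.

Lemma Rintegral_ge (f : T -> R) (h : T -> \bar R) (S : set T) : measurable S ->
  (forall x, ((\1_S x)%:E <= (f x)%:E)%E) -> (forall x, ((f x)%:E <= h x)%E) ->
  (\int[mu]_x h x < +oo)%E ->
  fine (mu S) <= (\int[mu]_x f x)%R.
Proof.
move=> mS Sf fh hfin.
have f0 x : (0 <= (f x)%:E)%E by apply: le_trans (Sf x); rewrite lee_fin.
have E : mu S = (\int[mu]_x (\1_S x)%:E)%E by rewrite integral_indic// setIT.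
have A : (mu S <= \int[mu]_x (f x)%:E)%E.
  by rewrite E; apply: le_integral_any => // x; rewrite lee_fin.
have B : (\int[mu]_x (f x)%:E < +oo)%E.
  by apply: le_lt_trans hfin; exact: le_integral_any.
have I0 : (0 <= \int[mu]_x (f x)%:E)%E by exact: integral_ge0.
rewrite /Rintegral fine_le// ge0_fin_numE//.
exact: le_lt_trans A B.
Qed.

Lemma Rintegral_null (f : T -> R) (K : set T) : mu.-negligible K ->
  (forall x, ~ K x -> f x = 0) -> (\int[mu]_x f x)%R = 0.
Proof.
move=> [N [mN N0 KN]] fK.
have IN : (\int[mu]_x ((cst +oo) \_ N) x = 0)%E.
  by rewrite -integral_mkcond integral_cst// N0 mule0.
apply/eqP; rewrite -normr_le0.
apply: (@le_trans _ _ (fine (\int[mu]_x ((cst +oo) \_ N) x)%E)); last by rewrite IN.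
apply: Rintegral_abs_le => [x|]; last by rewrite IN.
rewrite patchE; case: ifPn => [_|]; first by rewrite leey.
by rewrite notin_setE => Nx; rewrite fK ?normr0// => /KN.
Qed.

End RealIntegral.

(** * Test functions and the tension constant *)
Section TensionConstant.
Variables (R : realType) (n : nat) (M : riemannianManifold R n).
Implicit Types (p q x y : M) (i : chart_index M) (v : 'rV[R]_n) (u w : M -> R).

(** The scale in [exists_bump] is uniform near each point, hence on compact
    sets. *)
Lemma uniform_bump (K : set M) : compact K ->
  exists2 r : R, 0 < r & forall d, 0 < d < r -> forall q, K q -> exists b, bump_at q d b.
Proof.
move=> /compact_near_coveringP/(_ R (0 : R)^'+ (fun d q => exists b, bump_at q d b) _) H.
have : \forall d \near (0 : R)^'+, K `<=` (fun q => exists b, bump_at q d b).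
  apply: H => p _; have [r r0 Hr] := exists_bump p.
  have B : \forall d \near (0 : R)^'+, 0 < d < r.
    by near=> d; apply/andP; split; near: d; [exact: nbhs_right_gt|exact: nbhs_right_lt].
  exists ([set q | forall d, 0 < d < r -> exists b, bump_at q d b], [set d | 0 < d < r]) => //.
  by move=> [q d] /= [Hq] /Hq.
move=> /nbhs_ballP[r /= r0 Hr]; exists r => // d /andP[d0 dr].
by apply: Hr => //; rewrite /ball /= sub0r normrN gtr0_norm.
Unshelve. all: by end_near. Qed.

(** The gradient is defined with the inverse of the metric, and pairing with it
    gives back the differential; linearity of the differential in the
    direction is essential. *)
Lemma inner_grad u x v : smooth_fun u ->
  inner x v (grad u x) =
  'D_v (u \o chart_inv (chart_at x) : 'rV[R]_n -> R^o) (chart (chart_at x) x).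
Proof.
move=> su; set a := chart_at x; set z := chart a x.
have az : chart_cod a z by apply: chart_cod_chart; exact: mem_chart_at.
have Gp := metric_pos_form az.
rewrite (smooth_on_derive_sum v (@chart_cod_open _ _ M a) (su a) az).
rewrite /inner /grad -/a -/z trmx_mul trmx_inv (Defs.metric_sym az).
rewrite mulmxA -[v *m _ *m _]mulmxA mulmxV ?mulmx1; last exact: pos_form_unit.
by rewrite mxE; apply: eq_bigr => j _; rewrite !mxE.
Qed.

Variable mu : {measure set (borel M) -> \bar R}.

(** The unit field X / |X| pairs with grad u to at most |du|.  Where X vanishes
    the quotient is 0 and the bound still holds. *)
Lemma tension_pairing_le (X : M -> 'rV[R]_n) u (L : R) (S : set (borel M)) :
  smooth_fun u -> 0 <= L -> measurable S -> (mu S < +oo)%E ->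
  (forall x, deriv_le u x L) -> (forall x, ~ S x -> deriv_le u x 0) ->
  `|tension_pairing mu X u| <= L * fine (mu S).
Proof.
move=> su L0 mS Sfin uL uS.
have unit_le x : chart_norm (chart_at x) (chart (chart_at x) x) ((tnorm x (X x))^-1 *: X x) <= 1.
  rewrite /chart_norm mformZl mformZr mulrA -expr2 sqrtrM ?sqr_ge0// sqrtr_sqr.
  rewrite -[Num.sqrt _]/(tnorm x (X x)) ger0_norm ?invr_ge0 ?sqrtr_ge0//.
  by have [->|t0] := eqVneq (tnorm x (X x)) 0; [rewrite mulr0 ler01|rewrite mulVf].
have IE : (\int[mu]_x (L%:E * (\1_S x)%:E) = L%:E * mu S)%E.
  rewrite ge0_integralZl_EFin//.
    by rewrite integral_indic// setIT.
  by apply/measurable_EFinP; exact: measurable_indic.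
have -> : L * fine (mu S) = fine (\int[mu]_x (L%:E * (\1_S x)%:E))%E.
  by rewrite IE fineM// ge0_fin_numE.
apply: Rintegral_abs_le => [x|]; last first.
  by rewrite IE -(fineK (x := mu S)) ?ge0_fin_numE// -EFinM ltry.
rewrite inner_grad//; have ax := mem_chart_at x.
have [Sx|Sx] := pselect (S x).
  rewrite indicE mem_set// mule1 lee_fin (le_trans (uL x _ _ ax))//.
  by rewrite ler_piMr.
by rewrite indicE memNset// mule0 lee_fin (le_trans (uS x Sx _ _ ax))// mul0r.
Qed.

Hypothesis vol : is_riemannian_volume mu.
Hypothesis complM : complete_manifold M.
Variable D : R.
Hypothesis doubling : doubling_constant mu D.

Section Positive.
Variable x0 : M.
Hypothesis x0_pos : forall r, 0 < r -> (0 < mu (geodesic_ball x0 r))%E.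

Definition cutoff_lip : R := smooth_step_lip R * bump_lip R.

Lemma cutoff_lip_ge0 : 0 <= cutoff_lip.
Proof. by rewrite !mulr_ge0 ?expR_ge0. Qed.

(** The width of the annuli is d = r / K, with K so large that bumps exist at
    scale d around all points of B(x0, 2 r).  The slope C / d is divided by
    K, which leaves C / r: the choice of K disappears. *)
Lemma exists_cutoff r : 0 < r -> exists u, [/\ test_function u,
  forall x, \1_(geodesic_ball x0 r) x <= u x <= \1_(geodesic_ball x0 (2 * r)) x,
  forall x, deriv_le u x (cutoff_lip / r) &
  forall x, ~ geodesic_ball x0 (2 * r) x -> deriv_le u x 0].
Proof.
move=> r0; have r20 : 0 < 2 * r by rewrite mulr_gt0.
have [e e0 He] := uniform_bump (compact_closure_bounded vol doubling x0_pos complM r20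
  (@subset_refl _ (geodesic_ball x0 (2 * r)))).
have [K HK] := le_natr (r / e).
pose d := r / K.+1%:R.
have d0 : 0 < d by rewrite divr_gt0.
have de : d < e.
  by rewrite ltr_pdivrMr// mulrC -ltr_pdivrMr// (le_lt_trans HK)// ltr_nat.
have Kd : K.+1%:R * d = r by rewrite mulrC divfK.
have rr : r + K.+1%:R * d = 2 * r by rewrite Kd mulr2n mulrDl mul1r.
have dd0 : 0 < d / (2 * bump_lip R) by rewrite divr_gt0// mulr_gt0// bump_lip_gt0.
have [|s s0|u [su u0K uL u1 u0]] := @staircase R n M x0 d d0 r K.+1 r0.
- move=> q; rewrite rr => qr; apply: He; first by rewrite d0.
  exact: subset_closure.
- exact: (gball_totally_bounded vol doubling x0_pos s0 dd0).
rewrite rr in u0.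
have k0 : 0 <= K.+1%:R^-1 :> R by rewrite invr_ge0.
have uZ x : 0 <= K.+1%:R^-1 * u x <= 1.
  have /andP[a b] := u0K x; rewrite mulr_ge0//=.
  by rewrite ler_pdivrMl// mulr1.
exists (fun x => K.+1%:R^-1 * u x); split.
- split; first exact: smooth_funZ.
  apply: (compact_closure_bounded vol doubling x0_pos complM r20) => x /=.
  by apply: contraPP => /u0 ->; rewrite mulr0 eqxx.
- move=> x; have /andP[a b] := uZ x; rewrite !indicE; apply/andP; split.
    have [xr|xr] := pselect (geodesic_ball x0 r x); last by rewrite memNset.
    by rewrite mem_set// u1// mulVf.
  have [xr|xr] := pselect (geodesic_ball x0 (2 * r) x); first by rewrite mem_set.
  by rewrite memNset// u0// mulr0.
- move=> x; have := deriv_leZ su k0 (uL x); congr (deriv_le _ _ _).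
  rewrite /cutoff_lip /d; field.
  by rewrite !gt_eqF.
- move=> x xr; rewrite -(mulr0 K.+1%:R^-1); apply: deriv_leZ => //.
  apply: deriv_le_extremum => //; left => y; rewrite (u0 x)//.
  by have /andP[] := u0K y.
Qed.

(** The estimate |c| V(r) <= |c| int u <= (C / r) V(2 r) <= (C D / r) V(r) for the
    cutoff u, after division by V(r). *)
Lemma tension_constant_bound (X : M -> 'rV[R]_n) c r : 0 < r ->
  (forall psi, test_function psi ->
      tension_pairing mu X psi = - c * (\int[mu]_x psi x)%R) ->
  `|c| * r <= cutoff_lip * D.
Proof.
move=> r0 Hc; have [u [tu u1 uL u0]] := exists_cutoff r0.
have r20 : 0 < 2 * r by rewrite mulr_gt0.
have fin t : (mu (geodesic_ball x0 t) < +oo)%E by exact: (vol_ball_finite vol doubling x0 t).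
have fin' t : mu (geodesic_ball x0 t) \is a fin_num by rewrite ge0_fin_numE.
pose V t := fine (mu (geodesic_ball x0 t)).
have V0 : 0 < V r by rewrite fine_gt0// x0_pos// fin.
have mB t : measurable (geodesic_ball x0 t : set (borel M)) by exact: measurable_gball.
have Hge : V r <= (\int[mu]_x u x)%R.
  apply: (@Rintegral_ge _ _ _ mu u (fun x => (\1_(geodesic_ball x0 (2 * r)) x)%:E)) => //.
  - by move=> x; rewrite lee_fin; have /andP[] := u1 x.
  - by move=> x; rewrite lee_fin; have /andP[] := u1 x.
  - by rewrite integral_indic// setIT.
have Hle : `|c| * (\int[mu]_x u x)%R <= cutoff_lip / r * V (2 * r).
  have I0 : 0 <= (\int[mu]_x u x)%R by exact: le_trans (ltW V0) Hge.
  rewrite -{1}(ger0_norm I0) -normrM -normrN -mulNr -Hc//.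
  apply: tension_pairing_le => //; first by case: tu.
  by rewrite divr_ge0 ?cutoff_lip_ge0// ltW.
have Hd : V (2 * r) <= D * V r.
  have [_ /(_ r x0 r0)] := doubling.
  by rewrite -(fineK (fin' (2 * r))) -(fineK (fin' r)) -EFinM lee_fin.
have : `|c| * V r <= cutoff_lip / r * (D * V r).
  apply: (le_trans (ler_wpM2l (normr_ge0 c) Hge)); apply: (le_trans Hle).
  by rewrite ler_wpM2l// divr_ge0 ?cutoff_lip_ge0// ltW.
rewrite mulrA ler_pM2r// => H.
by rewrite -ler_pdivlMr// (le_trans H)// mulrAC.
Qed.

End Positive.

(** Otherwise the sets whose complement in [K] is null form a proper filter on
    [K]; at a cluster point, a null ball would meet its own complement. *)
Lemma null_of_locally_null (K : set M) : compact K ->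
  (forall x, exists2 r : R, 0 < r & mu (geodesic_ball x r) = 0%E) ->
  mu.-negligible (K : set (borel M)).
Proof.
move=> cK null; apply: contrapT => Kn.
pose F : set_system M := [set A | mu.-negligible (K `\` A : set (borel M))].
have FF : ProperFilter F.
  apply: Build_ProperFilter => [|/=].
    by rewrite /F /= setD0.
  split; rewrite /F /=.
  - by rewrite setDT; exact: negligible_set0.
  - by move=> A B /= KA KB; rewrite setDIr; exact: negligibleU.
  - by move=> A B AB /=; apply: negligibleS; exact: setDS.
have [|x [Kx Fx]] := cK F FF; first by rewrite /F /= setDv; exact: negligible_set0.
have [r r0 xr] := null x.
have FB : F (~` geodesic_ball x r).
  rewrite /F /= setDE setCK; exists (geodesic_ball x r); split=> //.
  exact: measurable_gball.
by have [y [/= ny yr]] := Fx _ _ FB (gball_nbhs x r0).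
Qed.

End TensionConstant.

Theorem proposition4p1 (R : realType) (n : nat) (M : riemannianManifold R n)
    (vol : {measure set (borel M) -> \bar R}) (D : R) (f : M -> R) (c : R)
    (vol_riemannian : is_riemannian_volume vol)
    (M_complete : complete_manifold M)
    (M_noncompact : ~ compact [set: M])
    (M_doubling : doubling_constant vol D)
    (f_subsolution : weak_subsolution vol f)
    (f_tension : constant_tension vol f c) :
  one_harmonic vol f.
Proof.
have [X gradX HX] := f_tension; exists X => // psi tpsi.
rewrite HX// oppr0 mul0r.
have [psi0|psi0] := eqVneq (\int[vol]_x psi x)%R 0; first by rewrite psi0 mulr0.
(* In the first case c = 0; in the second one the integral of psi is 0. *)
have [[x0 x0_pos]|nox] := pselect (exists x0 : M, forall r, 0 < r ->
    (0 < vol (geodesic_ball x0 r))%E).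
  have [->|c0] := eqVneq c 0; first by rewrite oppr0 mul0r.
  have C0 : 0 <= cutoff_lip R * D.
    by rewrite mulr_ge0 ?cutoff_lip_ge0//; case: M_doubling => /ltW.
  (* At this radius the bound |c| r <= C D reads C D + 1 <= C D. *)
  have r0 : 0 < (cutoff_lip R * D + 1) / `|c|.
    by rewrite divr_gt0 ?normr_gt0// ltr_wpDl.
  have := tension_constant_bound vol_riemannian M_complete M_doubling x0_pos r0 HX.
  by rewrite mulrC divfK ?normr_eq0// gerDl ler10.
case/negP: psi0; apply/eqP.
have [_ cpsi] := tpsi.
apply: (Rintegral_null (null_of_locally_null cpsi _)) => x; last first.
  by move=> xK; apply/eqP; apply: contrapT => /negP px; apply: xK; exact: subset_closure.
apply: contrapT => nx; apply: nox; exists x => r r0.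
rewrite lt_neqAle measure_ge0 andbT eq_sym; apply/negP => /eqP xr.
by apply: nx; exists r.
Qed.
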